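(* Let $\psi\in P_{\mathfrak{sl}_n}^+$, $c\in\mathbb{C}$, $\underline\beta\in\mathbb{C}^n$ and $\lambda\in P_{\mathfrak g}^+\setminus\{0\}$, with $\widehat G\lambda=\{\lambda_1,\dots,\lambda_l\}$ (of cardinality $l$), $S(\lambda)=k$ and $N=kl$. Let $V_1=V(c,\psi)$ and $V_2=\bigoplus_{\nu=1}^NV_2^\nu$, where each $V_2^\nu$ is one of $V(\lambda_1),\dots,V(\lambda_l)$, and let $\underline{a_1},\dots,\underline{a_N}\in\mathcal U(\underline m)$ be such that the twisted $\mathfrak g$-module structure on $V_2$ given by $x.\big(\sum_\nu v_2^\nu\big)=\sum_\nu\underline{a_\nu}^{\underline l}(x.v_2^\nu)$ ($x\in\mathfrak g_{\overline l}$, $v_2^\nu\in V_2^\nu$) is isomorphic, as an ungraded $\mathfrak g$-module, to $\bigoplus_{i=1}^lV(\lambda_i)^{\oplus k}$; equip this twisted module with a $G$-grading $V_2=\bigoplus_{\overline k\in G}V_{2,\overline k}$ making it $G$-graded-irreducible. Let $V'=\bigoplus_{\underline k\in\mathbb{Z}^n}V_1\otimes V_{2,\overline k}\otimes\mathbb{C}t^{\underline k}$, a submodule of the $\widetilde\tau$-module $V_1\otimes V_2\otimes A$ whose action is $$(x\otimes t^{\underline l}).\Big(\sum_{\nu}v_1\otimes v_2^\nu\otimes t^{\underline k}\Big)=\sum_{\nu}v_1\otimes\underline{a_\nu}^{\underline l}(x.v_2^\nu)\otimes t^{\underline k+\underline l},$$ $$t^{\underline r}d_i.\Big(\sum_{\nu}v_1\otimes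 v_2^\nu\otimes t^{\underline k}\Big)=(k_i+\beta_i)\sum_{\nu}v_1\otimes v_2^\nu\otimes t^{\underline k+\underline r}+\sum_{\nu}\sum_{j=1}^n\big((r_jm_jE_{ji}).v_1\big)\otimes v_2^\nu\otimes t^{\underline k+\underline r},$$ $$t^{\underline r}K_i.\Big(\sum_{\nu}v_1\otimes v_2^\nu\otimes t^{\underline k}\Big)=0$$ for $x\in\mathfrak g_{\overline l}$, $\underline k,\underline l\in\mathbb{Z}^n$, $\underline r=(r_1m_1,\dots,r_nm_n)\in\Gamma$, $v_1\in V_1$, $v_2^\nu\in V_2^\nu$, $1\le i\le n$. Then $V'$ is a level zero irreducible integrable $\widetilde\tau$-module with finite-dimensional weight spaces (with respect to $\widetilde{\mathfrak h}$) having a non-trivial $LT$-action.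
   Context: Everything is over $\mathbb{C}$. Let $\mathfrak g$ be a finite-dimensional simple Lie algebra with Cartan subalgebra $\mathfrak h$ and a symmetric non-degenerate bilinear form $(\cdot|\cdot)$ that is invariant and preserved by every automorphism of $\mathfrak g$. Let $n\in\mathbb{N}$ and let $\sigma_1,\dots,\sigma_n$ be commuting automorphisms of $\mathfrak g$ of finite orders $m_1,\dots,m_n$. Put $\Gamma=m_1\mathbb{Z}\oplus\dots\oplus m_n\mathbb{Z}$, $G=\mathbb{Z}^n/\Gamma$, write $\underline k\mapsto\overline k$ for $\mathbb{Z}^n\to G$, fix primitive $m_i$-th roots of unity $\xi_i$, and set $\mathfrak g_{\overline k}=\{x\in\mathfrak g: \sigma_i x=\xi_i^{k_i}x,\ 1\le i\le n\}$. Let $A=\mathbb{C}[t_1^{\pm1},\dots,t_n^{\pm1}]$, $t^{\underline k}=t_1^{k_1}\cdots t_n^{k_n}$, and $LT=\bigoplus_{\underline k\in\mathbb{Z}^n}\mathfrak g_{\overline k}\otimes\mathbb{C}t^{\underline k}$. Standing assumption ($LT$ is a Lie torus): (1) $\mathfrak g_{\overline 0}$ is a finite-dimensional simple Lie algebra; choose a Cartan subalgebra $\mathfrak h_{\overline0}\subseteq\mathfrak h$ of it; (2) for $\overline k\ne\overline0$ with $\mathfrak g_{\overline k}\neq 0$, $\mathfrak g_{\overline k}\cong U_{\overline k}\oplus W_{\overline k}$ as $\mathfrak g_{\overline0}$-module, where $U_{\overline k}$ is trivial and $W_{\overline k}$ is either zero or irreducible of dimension $>1$ with all $\mathfrak h_{\overline0}$-weights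 in $\Delta_{0,\mathrm{en}}$; (3) the group generated by the $\sigma_i$ has order $\prod_i m_i$. Here $\Delta_0^\times$ is the set of non-zero roots of $(\mathfrak g_{\overline0},\mathfrak h_{\overline0})$, $\Delta_{0,\mathrm{en}}^\times=\Delta_0^\times\cup2\Delta_{0,\mathrm{sh}}^\times$ if $\Delta_0^\times$ is of type $B_l$ ($\Delta_{0,\mathrm{sh}}^\times$ = short roots), $\Delta_{0,\mathrm{en}}^\times=\Delta_0^\times$ otherwise, and $\Delta_{0,\mathrm{en}}=\Delta_{0,\mathrm{en}}^\times\cup\{0\}$. For $\alpha\in\mathfrak h_{\overline0}^*$ put $\mathfrak g_{\overline k}(\alpha)=\{x\in\mathfrak g_{\overline k}:[h,x]=\alpha(h)x\ \forall h\in\mathfrak h_{\overline0}\}$. Twisted full toroidal Lie algebra: $\widetilde\tau=LT\oplus\mathcal Z(\underline m)\oplus\mathcal D(\underline m)$, where $\mathcal Z(\underline m)$ is spanned by symbols $t^{\underline r}K_i$ ($\underline r\in\Gamma$, $1\le i\le n$) modulo the relations $\sum_i r_it^{\underline r}K_i=0$, and $\mathcal D(\underline m)=\mathrm{span}\{t^{\underline r}d_i:\underline r\in\Gamma,1\le i\le n\}$. Brackets: $[x\otimes t^{\underline k},y\otimes t^{\underline l}]=[x,y]\otimes t^{\underline k+\underline l}+(x|y)\sum_ik_it^{\underline k+\underline l}K_i$; $\mathcal Z(\underline m)$ commutes with $LT\oplus\mathcal Z(\underline m)$; $[t^{\underline r}d_i,t^{\underline s}K_j]=s_it^{\underline r+\underline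 s}K_j+\delta_{ij}\sum_pr_pt^{\underline r+\underline s}K_p$; $[t^{\underline r}d_i,t^{\underline s}d_j]=s_it^{\underline r+\underline s}d_j-r_jt^{\underline r+\underline s}d_i+\phi(t^{\underline r}d_i,t^{\underline s}d_j)$; $[t^{\underline r}d_i,x\otimes t^{\underline k}]=k_i\,x\otimes t^{\underline k+\underline r}$. Here $\phi$ is a fixed linear combination of the cocycles $\phi_1(t^{\underline r}d_i,t^{\underline s}d_j)=-s_ir_j\sum_pr_pt^{\underline r+\underline s}K_p$ and $\phi_2(t^{\underline r}d_i,t^{\underline s}d_j)=r_is_j\sum_pr_pt^{\underline r+\underline s}K_p$. Put $\widetilde{\mathfrak h}=\mathfrak h_{\overline0}\oplus\sum_i\mathbb{C}K_i\oplus\sum_i\mathbb{C}d_i$. A $\widetilde\tau$-module is integrable if it is the direct sum of its $\widetilde{\mathfrak h}$-weight spaces and every element of $\mathfrak g_{\overline k}(\alpha)\otimes\mathbb{C}t^{\underline k}$, $\alpha\ne0$, acts locally nilpotently. It is of level zero if $K_1,\dots,K_n$ act by $0$. $P^+_{\mathfrak{s}}$ denotes the dominant integral weights of $\mathfrak s$. $V(c,\psi)$ is the finite-dimensional irreducible $\mathfrak{gl}_n(\mathbb{C})$-module with $\mathfrak{sl}_n$-highest weight $\psi$ on which the identity matrix acts by $c$; $E_{ij}$ are the matrix units. $V(\lambda)$ is the irreducible $\mathfrak g$-module of highest weight $\lambda$. $\widehat G=\mathrm{Hom}(G,\mathbb{C}^\times)$ acts on $\mathfrak g$ by automorphisms $\alpha_\chi(x)=\chi(\overline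 k)x$ ($x\in\mathfrak g_{\overline k}$), hence by twisting on isomorphism classes of finite-dimensional irreducible $\mathfrak g$-modules, hence on $P_{\mathfrak g}^+$; $\widehat G\lambda$ is the orbit. A $G$-graded $\mathfrak g$-module (with $\mathfrak g_{\overline k}M_{\overline l}\subseteq M_{\overline k+\overline l}$) is $G$-graded-irreducible if it has no proper non-zero graded submodule. The graded Schur index $S(\lambda)\in\mathbb{N}$ is the unique positive integer for which $\bigoplus_{i=1}^lV(\lambda_i)^{\oplus S(\lambda)}$ carries a $G$-grading making it a $G$-graded-irreducible $\mathfrak g$-module. $\mathcal U(\underline m)=\{\underline a\in\mathbb{C}^n:a_i^{m_i}=1\ \forall i\}$ and $\underline a^{\underline k}=\prod_ia_i^{k_i}$. *)

(* Defs.v *)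
From HB Require Import structures.
From mathcomp Require Import all_boot all_order all_algebra.
From mathcomp Require Import finmap.
From mathcomp Require Import reals complex.

Set Implicit Arguments.
Unset Strict Implicit.
Unset Printing Implicit Defensive.

Import GRing.Theory.

Local Open Scope ring_scope.

(* The direct sum of copies of V indexed by I; single i v is the family with
   value v at i and 0 elsewhere.  With I = Z^n this models V (x) A, the value
   at k being the coefficient of t^k. *)
Definition finfam (I : choiceType) (V : zmodType) := {fsfun I -> V with 0}.

Section FinFam.
Variables (I : choiceType).

Section Zmod.
Variable V : zmodType.
Implicit Types f g : finfam I V.

HB.instance Definition _ := Choice.copy (finfam I V) {fsfun I -> V with 0}.

Definition ff_zero : finfam I V := [fsfun with 0].
Definition ff_opp f : finfam I V := [fsfun i in finsupp f => - f i | 0].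
Definition ff_add f g : finfam I V :=
  [fsfun i in (finsupp f `|` finsupp g)%fset => f i + g i | 0].

Lemma ff_zeroE i : ff_zero i = 0.
Proof. exact: fsfun0E. Qed.

Lemma ff_oppE f i : ff_opp f i = - f i.
Proof. by rewrite fsfunE; case: finsuppP => //; rewrite oppr0. Qed.

Lemma ff_addE f g i : ff_add f g i = f i + g i.
Proof.
rewrite fsfunE in_fsetU; case: (finsuppP f) => //= _.
by case: (finsuppP g) => //= _; rewrite addr0.
Qed.

Fact ff_addA : associative ff_add.
Proof. by move=> f g h; apply/fsfunP => i; rewrite !ff_addE addrA. Qed.
Fact ff_addC : commutative ff_add.
Proof. by move=> f g; apply/fsfunP => i; rewrite !ff_addE addrC. Qed.
Fact ff_add0 : left_id ff_zero ff_add.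
Proof. by move=> f; apply/fsfunP => i; rewrite ff_addE ff_zeroE add0r. Qed.
Fact ff_addN : left_inverse ff_zero ff_opp ff_add.
Proof.
by move=> f; apply/fsfunP => i; rewrite ff_addE ff_oppE ff_zeroE addNr.
Qed.

HB.instance Definition _ :=
  GRing.isZmodule.Build (finfam I V) ff_addA ff_addC ff_add0 ff_addN.

Definition single (i : I) (v : V) : finfam I V :=
  [fsfun j in [fset i]%fset => v | 0].

Lemma singleE i v j : single i v j = if j == i then v else 0.
Proof. by rewrite fsfunE inE. Qed.

Lemma big_single (W : zmodType) (T : I -> V -> W) i v : T i 0 = 0 ->
  \sum_(j <- finsupp (single i v)) T j (single i v j) = T i v.
Proof.
move=> Ti0; rewrite (@big_fset_incl _ _ _ _ _ [fset i]%fset).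
- by rewrite big_seq_fset1 singleE eqxx.
- apply/fsubsetP => j; rewrite inE mem_finsupp singleE.
  by case: (j == i); rewrite ?eqxx.
- by move=> j; rewrite inE => /eqP-> /fsfun_dflt->.
Qed.

Lemma single0 i : single i (0 : V) = 0.
Proof. by apply/fsfunP => j; rewrite singleE fsfun0E if_same. Qed.

Lemma singleD i u v : single i (u + v) = single i u + single i v.
Proof.
by apply/fsfunP => j; rewrite ff_addE !singleE; case: eqP; rewrite ?addr0.
Qed.

Lemma single_sum (J : Type) (r : seq J) (P : pred J) (E : J -> V) i :
  single i (\sum_(j <- r | P j) E j) = \sum_(j <- r | P j) single i (E j).
Proof. by apply: (big_morph _ (singleD i) (single0 i)). Qed.

End Zmod.

Section Lmod.
Variables (F : nzRingType) (V : lmodType F).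
Implicit Types f g : finfam I V.

Definition ff_scale (a : F) f : finfam I V :=
  [fsfun i in finsupp f => a *: f i | 0].

Lemma ff_scaleE a f i : ff_scale a f i = a *: f i.
Proof. by rewrite fsfunE; case: finsuppP => //; rewrite scaler0. Qed.

Fact ff_scaleA a b f : ff_scale a (ff_scale b f) = ff_scale (a * b) f.
Proof. by apply/fsfunP => i; rewrite !ff_scaleE scalerA. Qed.
Fact ff_scale1 : left_id 1 ff_scale.
Proof. by move=> f; apply/fsfunP => i; rewrite ff_scaleE scale1r. Qed.
Fact ff_scaleDr : right_distributive ff_scale +%R.
Proof.
by move=> a f g; apply/fsfunP => i; rewrite !(ff_scaleE, ff_addE) scalerDr.
Qed.
Fact ff_scaleDl f : {morph ff_scale^~ f : a b / a + b}.
Proof.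
by move=> a b; apply/fsfunP => i; rewrite !(ff_scaleE, ff_addE) scalerDl.
Qed.

HB.instance Definition _ :=
  GRing.Zmodule_isLmodule.Build F (finfam I V)
    ff_scaleA ff_scale1 ff_scaleDr ff_scaleDl.

Lemma singleZ i a (v : V) : single i (a *: v) = a *: single i v.
Proof.
by apply/fsfunP => j; rewrite ff_scaleE !singleE; case: eqP; rewrite ?scaler0.
Qed.

End Lmod.
End FinFam.

Section LieModules.
Variables (F : fieldType) (L V : lmodType F).

Definition lie_bracket (br : L -> L -> L) : Prop :=
  [/\ forall a x y z, br (a *: x + y) z = a *: br x z + br y z,
      forall a x y z, br z (a *: x + y) = a *: br z x + br z y,
      forall x, br x x = 0
    & forall x y z, br x (br y z) + br y (br z x) + br z (br x y) = 0].

Definition subspace (W : V -> Prop) : Prop :=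
  W 0 /\ forall (a : F) u v, W u -> W v -> W (a *: u + v).

(* Below, T is the underlying set of a Lie algebra with bracket br, and W that
   of a module; only the values of br and act on T and W matter. *)
Definition stable_under (T : L -> Prop) (act : L -> V -> V) (W : V -> Prop) :=
  forall x w, T x -> W w -> W (act x w).

Definition lie_module (T : L -> Prop) (br : L -> L -> L)
    (W : V -> Prop) (act : L -> V -> V) : Prop :=
  [/\ subspace W, stable_under T act W,
      forall a x y w, T x -> T y -> W w ->
        act (a *: x + y) w = a *: act x w + act y w,
      forall a x v w, T x -> W v -> W w ->
        act x (a *: v + w) = a *: act x v + act x w
    & forall x y w, T x -> T y -> W w ->
        act (br x y) w = act x (act y w) - act y (act x w)].

Definition irreducible_module (T : L -> Prop) (W : V -> Prop)
    (act : L -> V -> V) : Prop :=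
  (exists2 w, W w & w != 0) /\
  forall U : V -> Prop, subspace U -> (forall u, U u -> W u) ->
    stable_under T act U ->
    (forall u, U u -> u = 0) \/ (forall w, W w -> U w).

End LieModules.

Section FiniteDimensional.
Variables (F : fieldType) (g : vectType F) (br : g -> g -> g).

Definition subalgebra (S : {vspace g}) : Prop :=
  forall x y, x \in S -> y \in S -> br x y \in S.

Definition simple_lie (S : {vspace g}) : Prop :=
  [/\ subalgebra S,
      exists x y, [/\ x \in S, y \in S & br x y != 0]
    & forall I : {vspace g}, (I <= S)%VS ->
        (forall x y, x \in S -> y \in I -> br x y \in I) ->
        I = 0%VS \/ I = S].

(* Cartan subalgebras of complex semisimple Lie algebras: abelian,
   self-centralizing and acting diagonalizably. *)
Definition cartan (S h : {vspace g}) : Prop :=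
  [/\ (h <= S)%VS,
      forall u v, u \in h -> v \in h -> br u v = 0,
      forall x, x \in S -> (forall u, u \in h -> br u x = 0) -> x \in h
    & forall u, u \in h -> exists2 X : seq g, basis_of S X &
        forall x, x \in X -> exists c : F, br u x = c *: x].

Definition automorphism (theta : 'End(g)) : Prop :=
  lker theta = 0%VS /\ forall x y, theta (br x y) = br (theta x) (theta y).

Definition nice_form (frm : g -> g -> F) : Prop :=
  [/\ forall a x y z, frm (a *: x + y) z = a * frm x z + frm y z,
      forall x y, frm x y = frm y x,
      forall x, (forall y, frm x y = 0) -> x = 0,
      forall x y z, frm (br x y) z = frm x (br y z)
    & forall theta, automorphism theta ->
        forall x y, frm (theta x) (theta y) = frm x y].

(* Elements of h^* are linear maps on the subspace h. *)
Local Notation dual h := 'Hom(subvs_of h, F^o).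

Section Weights.
Variables (S h : {vspace g}).

Definition root_vector (alpha : dual h) (x : g) : Prop :=
  x \in S /\ forall u : subvs_of h, br (vsval u) x = alpha u *: x.

Definition root (alpha : dual h) : Prop :=
  alpha != 0 /\ exists2 x, root_vector alpha x & x != 0.

Definition nat_comb (Pi : seq (dual h)) (alpha : dual h) : Prop :=
  exists c : nat -> nat, alpha = \sum_(i < size Pi) Pi`_i *+ c i.

Definition root_base (Pi : seq (dual h)) : Prop :=
  [/\ basis_of fullv Pi,
      forall alpha, alpha \in Pi -> root alpha
    & forall alpha, root alpha -> nat_comb Pi alpha \/ nat_comb Pi (- alpha)].

Definition positive_root (Pi : seq (dual h)) (alpha : dual h) : Prop :=
  root alpha /\ nat_comb Pi alpha.

Definition coroot (alpha : dual h) (u : subvs_of h) : Prop :=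
  alpha u = 2%:R /\
  exists x y, [/\ root_vector alpha x, root_vector (- alpha) y
                & vsval u = br x y].

Definition dominant_integral (pos : dual h -> Prop) (lam : dual h) : Prop :=
  forall alpha u, pos alpha -> coroot alpha u ->
    exists j : nat, lam u = j%:R.

End Weights.

(* A representation on the column space F^q, x acting as rho x *m _. *)
Section Rep.
Variables (q : nat) (rho : g -> 'M[F]_q).

Definition lie_rep : Prop :=
  (forall a x y, rho (a *: x + y) = a *: rho x + rho y) /\
  (forall x y, rho (br x y) = rho x *m rho y - rho y *m rho x).

Definition invariant (U : {vspace 'cV[F]_q}) : Prop :=
  forall x v, v \in U -> rho x *m v \in U.

Definition irreducible_rep : Prop :=
  (0 < q)%N /\ forall U, invariant U -> U = 0%VS \/ U = fullv.

Definition highest_weight (S h : {vspace g}) (pos : dual h -> Prop)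
    (lam : dual h) : Prop :=
  exists v : 'cV[F]_q, [/\ v != 0,
    forall u : subvs_of h, rho (vsval u) *m v = lam u *: v
  & forall alpha x, pos alpha -> root_vector S alpha x -> rho x *m v = 0].

End Rep.

Definition rep_iso q q' (rho : g -> 'M[F]_q) (rho' : g -> 'M[F]_q') : Prop :=
  exists (P : 'M[F]_(q', q)) (P' : 'M[F]_(q, q')),
    [/\ P *m P' = 1%:M, P' *m P = 1%:M
      & forall x, P *m rho x = rho' x *m P].

(* rho is a realization of V(lam). *)
Definition hw_irrep (h : {vspace g}) (pos : dual h -> Prop) (lam : dual h)
    q (rho : g -> 'M[F]_q) : Prop :=
  [/\ lie_rep rho, irreducible_rep rho & highest_weight rho fullv pos lam].

(* alpha is of the form +- e_i or +- e_i +- e_j (i < j); in rank 1 (B_1 = A_1)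
   every root is short. *)
Definition short_B (h : {vspace g}) (e : seq (dual h)) (alpha : dual h) :=
  exists2 i, (i < size e)%N & alpha = e`_i \/ alpha = - e`_i.

Definition type_B (h : {vspace g}) (e : seq (dual h))
    (Delta : dual h -> Prop) : Prop :=
  [/\ (0 < size e)%N, basis_of fullv e
    & forall alpha, Delta alpha <->
        short_B e alpha \/
        exists i j (a b : bool), (i < j < size e)%N /\
          alpha = (-1) ^+ a *: e`_i + (-1) ^+ b *: e`_j].

Definition enlarged (h : {vspace g}) (Delta : dual h -> Prop)
    (alpha : dual h) : Prop :=
  [\/ alpha = 0, Delta alpha
    | exists2 e, type_B e Delta &
        exists2 beta, short_B e beta & alpha = beta *+ 2].

End FiniteDimensional.

Notation dual F h := 'Hom(subvs_of h, F^o).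

Section GeneralLinear.
Variables (F : fieldType) (n : nat).

Definition gl_bracket (A B : 'M[F]_n) : 'M[F]_n := A *m B - B *m A.

Definition sl_space : {vspace 'M[F]_n} :=
  lker (linfun (mxtrace : 'M[F]_n -> F^o)).

Definition sl_cartan : {vspace 'M[F]_n} :=
  (sl_space :&: limg (linfun (@diag_mx F n)))%VS.

Definition sl_positive (alpha : dual F sl_cartan) : Prop :=
  exists i j : 'I_n, (i < j)%N /\
    forall u, alpha u = vsval u i i - vsval u j j.

Definition sl_dominant_integral (psi : dual F sl_cartan) : Prop :=
  dominant_integral gl_bracket sl_space sl_positive psi.

(* eta is a realization of V(c, psi). *)
Definition gl_irrep (c : F) (psi : dual F sl_cartan) p
    (eta : 'M[F]_n -> 'M[F]_p) : Prop :=
  [/\ lie_rep gl_bracket eta, irreducible_rep eta, eta 1%:M = c%:M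
    & highest_weight gl_bracket eta sl_space sl_positive psi].

End GeneralLinear.

Notation Zn n := 'rV[int]_n.

(* G = Z^n / Gamma = Z/m_1 x .. x Z/m_n, for m_i > 0; the predecessor and
   successor make each factor a zmodType, including the case m_i = 1. *)
Definition quotG n (m : 'I_n -> nat) :=
  {dffun forall i : 'I_n, 'I_(m i).-1.+1}.

Section QuotG.
Variables (n : nat) (m : 'I_n -> nat).

HB.instance Definition _ :=
  Finite.copy (quotG m) {dffun forall i : 'I_n, 'I_(m i).-1.+1}.

Definition G_zero : quotG m := [ffun i : 'I_n => 0 : 'I_(m i).-1.+1].
Definition G_opp (a : quotG m) : quotG m :=
  [ffun i : 'I_n => - a i : 'I_(m i).-1.+1].
Definition G_add (a b : quotG m) : quotG m :=
  [ffun i : 'I_n => a i + b i : 'I_(m i).-1.+1].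

Fact G_addA : associative G_add.
Proof. by move=> a b c; apply/ffunP => i; rewrite !ffunE addrA. Qed.
Fact G_addC : commutative G_add.
Proof. by move=> a b; apply/ffunP => i; rewrite !ffunE addrC. Qed.
Fact G_add0 : left_id G_zero G_add.
Proof. by move=> a; apply/ffunP => i; rewrite !ffunE add0r. Qed.
Fact G_addN : left_inverse G_zero G_opp G_add.
Proof. by move=> a; apply/ffunP => i; rewrite !ffunE addNr. Qed.

HB.instance Definition _ :=
  GRing.isZmodule.Build (quotG m) G_addA G_addC G_add0 G_addN.

Definition Gclass (k : Zn n) : quotG m :=
  [ffun i : 'I_n => inZp `|(k 0%R i %% (m i)%:Z)%Z|%N].

Definition Grep (a : quotG m) : Zn n := \row_i (a i : nat)%:Z.

Definition Gamma (r : Zn n) : Prop := forall i, ((m i)%:Z %| r 0%R i)%Z.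

(* Hom(G, F^x); multiplicativity and chi 0 = 1 make the values non-zero. *)
Definition Gchar (F : fieldType) (chi : quotG m -> F) : Prop :=
  chi 0 = 1 /\ forall a b, chi (a + b) = chi a * chi b.

End QuotG.

Section MultiloopTorus.
Variables (F : fieldType) (g : vectType F) (br : g -> g -> g).
Variables (n : nat) (m : 'I_n -> nat) (sigma : 'I_n -> 'End(g)).
Variable xi : 'I_n -> F.

Definition exact_order (f : 'End(g)) (d : nat) : Prop :=
  [/\ (0 < d)%N, iter d f =1 id
    & forall j, (0 < j < d)%N -> ~ iter j f =1 id].

Inductive generated : 'End(g) -> Prop :=
| generated1 : generated \1%VF
| generatedM i f : generated f -> generated (sigma i \o f)%VF
| generatedV i f : generated f -> generated ((sigma i)^-1 \o f)%VF.

Definition gk (k : Zn n) : {vspace g} :=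
  (\bigcap_(i < n) passmx.leigenspace (sigma i) (xi i ^ k 0%R i)%R)%VS.

Definition multiloop_data : Prop :=
  [/\ forall i, automorphism br (sigma i),
      forall i j, (sigma i \o sigma j = sigma j \o sigma i)%VF,
      forall i, exact_order (sigma i) (m i)
    & forall i, (m i).-primitive_root (xi i)].

Definition g0_stable (W : {vspace g}) : Prop :=
  forall x w, x \in gk 0 -> w \in W -> br x w \in W.

Definition g0_irreducible (W : {vspace g}) : Prop :=
  W <> 0%VS /\ forall W' : {vspace g}, (W' <= W)%VS -> g0_stable W' ->
    W' = 0%VS \/ W' = W.

Definition lie_torus (h h0 : {vspace g}) : Prop :=
  [/\ simple_lie br (gk 0),
      cartan br (gk 0) h0 /\ (h0 <= h)%VS,
      forall k, Gclass m k != 0 -> gk k <> 0%VS ->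
        exists U W : {vspace g},
        [/\ (U + W)%VS = gk k, (U :&: W)%VS = 0%VS,
            forall x u, x \in gk 0 -> u \in U -> br x u = 0,
            g0_stable W
          & W = 0%VS \/
            [/\ g0_irreducible W, (1 < \dim W)%N
              & forall (alpha : dual F h0) w, root_vector br W alpha w ->
                  w != 0 -> enlarged (root br (gk 0) (h:=h0)) alpha]]
    & exists s : seq 'End(g),
        [/\ uniq s, size s = (\prod_(i < n) m i)%N
          & forall f, f \in s <-> generated f]].

(* The projection of g = (+)_a g_a onto its component of class a. *)
Definition gcomp (a : quotG m) : 'End(g) :=
  sumv_pi (\sum_(b : quotG m) gk (Grep b))%VS a.

Definition twist_aut (chi : quotG m -> F) : 'End(g) :=
  \sum_(a : quotG m) chi a *: gcomp a.

Definition twist_orbit (h : {vspace g}) (pos : dual F h -> Prop)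
    (lam mu : dual F h) : Prop :=
  exists2 chi : quotG m -> F, Gchar chi &
    exists q (rho : g -> 'M[F]_q),
      hw_irrep br pos lam rho /\
      hw_irrep br pos mu (fun x => rho (twist_aut chi x)).

Section Graded.
Variables (q : nat) (rho : g -> 'M[F]_q).
Variable gr : quotG m -> {vspace 'cV[F]_q}.

Definition is_grading : Prop :=
  [/\ directv (\sum_(a : quotG m) gr a)%VS,
      (\sum_(a : quotG m) gr a)%VS = fullv
    & forall k a x v, x \in gk k -> v \in gr a ->
        rho x *m v \in gr (Gclass m k + a)].

Definition graded_irreducible : Prop :=
  [/\ is_grading, (0 < q)%N
    & forall U : {vspace 'cV[F]_q}, invariant rho U ->
        (\sum_(a : quotG m) (U :&: gr a))%VS = U ->
        U = 0%VS \/ U = fullv].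

End Graded.

Section Sums.
Variables (l : nat) (q : 'I_l -> nat) (rho : forall i, g -> 'M[F]_(q i)).

(* (+)_i V(lam_i)^(+ s) *)
Definition multiple_sum (s : nat) (x : g) :
    'M[F]_(\sum_(i < l) \sum_(j < s) q i) :=
  \mxdiag_(i < l) \mxdiag_(j < s) rho i x.

Definition schur_multiplicity (s : nat) : Prop :=
  (0 < s)%N /\ exists gr, graded_irreducible (multiple_sum s) gr.

Definition graded_schur_index (s : nat) : Prop := unique schur_multiplicity s.

Definition torsion_point (a : 'rV[F]_n) : Prop := forall i, a 0 i ^+ m i = 1.

Definition mpow (a : 'rV[F]_n) (k : Zn n) : F :=
  \prod_(i < n) a 0 i ^ k 0 i.

Variables (N : nat) (s : 'I_N -> 'I_l) (a : 'I_N -> 'rV[F]_n).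

(* The operator (v_nu)_nu |-> (a_nu^k (x . v_nu))_nu on
   V_2 = (+)_nu V_2^nu, where V_2^nu = V(lam_(s nu)). *)
Definition twisted_op (k : Zn n) (x : g) :
    'M[F]_(\sum_(nu < N) q (s nu)) :=
  \mxdiag_(nu < N) (mpow (a nu) k *: rho (s nu) x).

Definition twisted_rep (x : g) : 'M[F]_(\sum_(nu < N) q (s nu)) :=
  \sum_(b : quotG m) twisted_op (Grep b) (gcomp b x).

End Sums.
End MultiloopTorus.

Section Toroidal.
Variables (F : fieldType) (n : nat).

Definition intv (k : Zn n) : 'rV[F]_n := map_mx intr k.

Definition dot (u v : 'rV[F]_n) : F := \sum_i u 0 i * v 0 i.

(* Modulo the relation \sum_i r_i t^r K_i = 0, the span of the t^r K_i is
   F^n / F r.  Cosets are represented by their unique element in the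
   complement r^C of the line, so tK r v is the class of
   \sum_i v_i t^r K_i. *)
Definition tK (r : Zn n) (v : 'rV[F]_n) : finfam (Zn n) 'rV[F]_n :=
  single r (v *m proj_mx (intv r)^C%MS <<intv r>>%MS).

Variables (g : vectType F) (br : g -> g -> g) (frm : g -> g -> F).

(* Triples (f, z, d): f k is the coefficient of t^k in g (x) A, z r the part
   of degree r of the centre, and d r the vector (d_i)_i of
   \sum_i d_i t^r d_i.  The twisted algebra is the subspace [twisted_toroidal]
   below. *)
Definition toroidal : lmodType F :=
  (finfam (Zn n) g * finfam (Zn n) 'rV[F]_n * finfam (Zn n) 'rV[F]_n)%type.

Definition elt_loop (k : Zn n) (x : g) : toroidal := (single k x, 0, 0).
Definition elt_K (r : Zn n) (v : 'rV[F]_n) : toroidal := (0, tK r v, 0).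
Definition elt_d (r : Zn n) (u : 'rV[F]_n) : toroidal := (0, 0, single r u).

Implicit Types (f : finfam (Zn n) g) (z d : finfam (Zn n) 'rV[F]_n).

Definition loop_loop f f' : finfam (Zn n) g :=
  \sum_(k <- finsupp f) \sum_(l <- finsupp f')
    single (k + l) (br (f k) (f' l)).

Definition loop_cocycle f f' : finfam (Zn n) 'rV[F]_n :=
  \sum_(k <- finsupp f) \sum_(l <- finsupp f')
    tK (k + l) (frm (f k) (f' l) *: intv k).

Definition d_loop d f : finfam (Zn n) g :=
  \sum_(r <- finsupp d) \sum_(k <- finsupp f)
    single (k + r) (dot (d r) (intv k) *: f k).

Definition d_K d z : finfam (Zn n) 'rV[F]_n :=
  \sum_(r <- finsupp d) \sum_(s <- finsupp z)
    tK (r + s) (dot (d r) (intv s) *: z s + dot (d r) (z s) *: intv r).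

Definition d_d d d' : finfam (Zn n) 'rV[F]_n :=
  \sum_(r <- finsupp d) \sum_(s <- finsupp d')
    single (r + s) (dot (d r) (intv s) *: d' s - dot (d' s) (intv r) *: d r).

Definition phi1 d d' : finfam (Zn n) 'rV[F]_n :=
  \sum_(r <- finsupp d) \sum_(s <- finsupp d')
    tK (r + s) (- (dot (d r) (intv s) * dot (d' s) (intv r)) *: intv r).

Definition phi2 d d' : finfam (Zn n) 'rV[F]_n :=
  \sum_(r <- finsupp d) \sum_(s <- finsupp d')
    tK (r + s) ((dot (d r) (intv r) * dot (d' s) (intv s)) *: intv r).

(* The bracket attached to phi = c1 phi_1 + c2 phi_2. *)
Definition toroidal_bracket (c1 c2 : F) (X Y : toroidal) : toroidal :=
  let: (f, z, d) := X in
  let: (f', z', d') := Y in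
  (loop_loop f f' + d_loop d f' - d_loop d' f,
   loop_cocycle f f' + d_K d z' - d_K d' z + (c1 *: phi1 d d' + c2 *: phi2 d d'),
   d_d d d').

Lemma dotDr u v w : dot u (v + w) = dot u v + dot u w.
Proof. by rewrite /dot -big_split; apply: eq_bigr => i _; rewrite mxE mulrDr. Qed.
Lemma dotZr c u v : dot u (c *: v) = c * dot u v.
Proof.
by rewrite /dot mulr_sumr; apply: eq_bigr => i _; rewrite mxE mulrCA.
Qed.
Lemma dot0r u : dot u 0 = 0.
Proof. by rewrite -(scale0r 0) dotZr mul0r. Qed.
Lemma dotC u v : dot u v = dot v u.
Proof. by apply: eq_bigr => i _; rewrite mulrC. Qed.
Lemma dot0l u : dot 0 u = 0.
Proof. by rewrite dotC dot0r. Qed.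

Lemma intvD r s : intv (r + s) = intv r + intv s.
Proof. exact: map_mxD. Qed.

Lemma tK0 r : tK r 0 = 0.
Proof. by rewrite /tK mul0mx single0. Qed.

Lemma tKD r u v : tK r (u + v) = tK r u + tK r v.
Proof. by rewrite /tK mulmxDl singleD. Qed.

Lemma tKZ r c v : tK r (c *: v) = c *: tK r v.
Proof. by rewrite /tK -scalemxAl singleZ. Qed.

Lemma line_compl_disjoint (r : Zn n) :
  ((intv r)^C :&: <<intv r>>)%MS = 0 :> 'M_n.
Proof.
apply/eqP; rewrite -submx0 capmxC (cap_eqmx (genmxE _) (eqmx_refl _)).
by rewrite capmx_compl submx_refl.
Qed.

Lemma tK_rel r (c : F) : tK r (c *: intv r) = 0.
Proof.
rewrite /tK proj_mx_0 ?single0 ?line_compl_disjoint //.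
by rewrite genmxE scalemx_sub.
Qed.

Lemma tK_eq0 r v : tK r v = 0 -> exists c, v = c *: intv r.
Proof.
move/fsfunP/(_ r); rewrite singleE eqxx fsfun0E => v0.
have: (v - v *m proj_mx (intv r)^C%MS <<intv r>>%MS <= <<intv r>>)%MS.
  apply: proj_mx_compl_sub; rewrite addsmxC.
  by rewrite (adds_eqmx (genmxE _) (eqmx_refl _)) submx_full // addsmx_compl_full.
by rewrite v0 subr0 genmxE => /sub_rVP.
Qed.

Lemma d_loop0 d : d_loop d 0 = 0.
Proof. by rewrite /d_loop big1 // => j _; rewrite finsupp0 big_seq_fset0. Qed.

Lemma d_K0 d : d_K d 0 = 0.
Proof. by rewrite /d_K big1 // => j _; rewrite finsupp0 big_seq_fset0. Qed.

(* The brackets of the spanning elements. *)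
Lemma bracket_loop_loop c1 c2 k l x y :
  (forall x', br 0 x' = 0) -> (forall x', br x' 0 = 0) ->
  (forall x', frm 0 x' = 0) -> (forall x', frm x' 0 = 0) ->
  toroidal_bracket c1 c2 (elt_loop k x) (elt_loop l y) =
  elt_loop (k + l) (br x y) + elt_K (k + l) (frm x y *: intv k).
Proof.
move=> br0l br0r frm0l frm0r.
rewrite /toroidal_bracket /elt_loop /elt_K /d_loop /d_K /d_d /phi1 /phi2.
rewrite !finsupp0 !big_seq_fset0.
rewrite /loop_loop (@big_single _ _ _ (fun k' x' => \sum_(l' <- _)
  single (k' + l') (br x' (single l y l')))); last first.
  by rewrite big1 // => j _; rewrite br0l single0.
rewrite (@big_single _ _ _ (fun l' y' => single (k + l') (br x y'))); last first.
  by rewrite br0r single0.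
rewrite /loop_cocycle (@big_single _ _ _ (fun k' x' => \sum_(l' <- _)
  tK (k' + l') (frm x' (single l y l') *: intv k'))); last first.
  by rewrite big1 // => j _; rewrite frm0l scale0r tK0.
rewrite (@big_single _ _ _ (fun l' y' => tK (k + l') (frm x y' *: intv k)));
  last by rewrite frm0r scale0r tK0.
by rewrite !scaler0 !addr0 !subr0; congr (_, _, _); rewrite ?addr0 ?add0r.
Qed.

Lemma bracket_d_loop c1 c2 r u k x :
  toroidal_bracket c1 c2 (elt_d r u) (elt_loop k x) =
  elt_loop (k + r) (dot u (intv k) *: x).
Proof.
rewrite /toroidal_bracket /elt_loop /elt_d /loop_loop /loop_cocycle /d_K /d_d.
rewrite /phi1 /phi2 /d_loop !finsupp0 !big_seq_fset0.
rewrite (@big_single _ _ _ (fun r' u' => \sum_(k' <- _)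
  single (k' + r') (dot u' (intv k') *: single k x k'))); last first.
  by rewrite big1 // => j _; rewrite dot0l scale0r single0.
rewrite (@big_single _ _ _ (fun k' x' =>
  single (k' + r) (dot u (intv k') *: x'))); last by rewrite scaler0 single0.
congr (_, _, _); last first.
- by rewrite big1 // => j _; rewrite big_seq_fset0.
- by rewrite !big1 ?scaler0 ?addr0 ?subr0 // => j _; rewrite big_seq_fset0.
by rewrite add0r subr0.
Qed.

Lemma bracket_d_K c1 c2 r u s v :
  toroidal_bracket c1 c2 (elt_d r u) (elt_K s v) =
  elt_K (r + s) (dot u (intv s) *: v + dot u v *: intv r).
Proof.
rewrite /toroidal_bracket /elt_K /elt_d /loop_loop /loop_cocycle /d_K /d_d.
rewrite /phi1 /phi2 /d_loop !finsupp0 !big_seq_fset0.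
congr (_, _, _).
- by rewrite big1 ?addr0 ?subr0 // => j _; rewrite big_seq_fset0.
- rewrite (@big_single _ _ _ (fun r' u' => \sum_(s' <- _)
    tK (r' + s') (dot u' (intv s') *: tK s v s' + dot u' (tK s v s') *: intv r')));
    last by rewrite big1 // => j _; rewrite !dot0l !scale0r addr0 tK0.
  rewrite {1 2 3}/tK (@big_single _ _ _ (fun s' v' =>
    tK (r + s') (dot u (intv s') *: v' + dot u v' *: intv r)));
    last by rewrite scaler0 dot0r scale0r addr0 tK0.
  set v' := v *m _.
  have [c vE] : exists c, v - v' = c *: intv s.
    apply: tK_eq0; rewrite /tK mulmxBl -mulmxA proj_mx_proj ?subrr ?single0 //.
    exact: line_compl_disjoint.
  have -> : v = v' + c *: intv s by rewrite -vE addrC subrK.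
  rewrite !big1; first last.
  + by move=> j _; rewrite big_seq_fset0.
  + by move=> j _; rewrite big_seq_fset0.
  rewrite !scaler0 !addr0 add0r subr0.
  rewrite dotDr dotZr scalerDr scalerDl addrACA.
  rewrite [in RHS]tKD -[LHS]addr0; congr (_ + _).
  rewrite scalerA mulrC -scalerDr -intvD addrC; exact/esym/tK_rel.
- by rewrite big1 // => j _; rewrite big_seq_fset0.
Qed.

Lemma bracket_d_d c1 c2 r u s v :
  toroidal_bracket c1 c2 (elt_d r u) (elt_d s v) =
  elt_d (r + s) (dot u (intv s) *: v - dot v (intv r) *: u) +
  elt_K (r + s) ((c2 * (dot u (intv r) * dot v (intv s)) -
                  c1 * (dot u (intv s) * dot v (intv r))) *: intv r).
Proof.
rewrite /toroidal_bracket /elt_K /elt_d !d_K0 !d_loop0.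
rewrite /loop_loop /loop_cocycle !finsupp0 !big_seq_fset0 !subr0 !addr0.
congr (_, _, _); rewrite ?addr0 ?add0r //.
- rewrite /phi1 (@big_single _ _ _ (fun r' u' => \sum_(s' <- _)
    tK (r' + s') (- (dot u' (intv s') * dot (single s v s') (intv r')) *: intv r')));
    last by rewrite big1 // => j _; rewrite dot0l mul0r oppr0 scale0r tK0.
  rewrite (@big_single _ _ _ (fun s' v' =>
    tK (r + s') (- (dot u (intv s') * dot v' (intv r)) *: intv r)));
    last by rewrite dot0l mulr0 oppr0 scale0r tK0.
  rewrite /phi2 (@big_single _ _ _ (fun r' u' => \sum_(s' <- _)
    tK (r' + s') ((dot u' (intv r') * dot (single s v s') (intv s')) *: intv r')));
    last by rewrite big1 // => j _; rewrite dot0l mul0r scale0r tK0.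
  rewrite (@big_single _ _ _ (fun s' v' =>
    tK (r + s') ((dot u (intv r) * dot v' (intv s')) *: intv r)));
    last by rewrite dot0l mulr0 scale0r tK0.
  by rewrite -!tKZ -tKD !scalerA -scalerDl mulrN [- _ + _]addrC.
rewrite /d_d (@big_single _ _ _ (fun r' u' => \sum_(s' <- _) single (r' + s')
  (dot u' (intv s') *: single s v s' - dot (single s v s') (intv r') *: u')));
  last by rewrite big1 // => j _; rewrite dot0l scale0r scaler0 subrr single0.
rewrite (@big_single _ _ _ (fun s' v' => single (r + s')
  (dot u (intv s') *: v' - dot v' (intv r) *: u))) //.
by rewrite dot0l scale0r scaler0 subrr single0.
Qed.

Variables (m : 'I_n -> nat) (sigma : 'I_n -> 'End(g)) (xi : 'I_n -> F).

Definition twisted_toroidal (X : toroidal) : Prop :=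
  let: (f, z, d) := X in
  [/\ forall k, f k \in gk sigma xi k,
      forall r, (z r <= (intv r)^C)%MS,
      forall r, ~ Gamma m r -> z r = 0
    & forall r, ~ Gamma m r -> d r = 0].

Section Cartan.
Variable h0 : {vspace g}.

Definition htilde : vectType F :=
  (subvs_of h0 * 'rV[F]_n * 'rV[F]_n)%type.

Definition htilde_elt (H : htilde) : toroidal :=
  elt_loop 0 (vsval H.1.1) + elt_K 0 H.1.2 + elt_d 0 H.2.

Variables (V : lmodType F) (W : V -> Prop) (act : toroidal -> V -> V).

Definition weight_vector (Lam : 'Hom(htilde, F^o)) (w : V) : Prop :=
  W w /\ forall H, act (htilde_elt H) w = Lam H *: w.

Definition direct_sum_of_weight_spaces : Prop :=
  (forall w, W w -> exists (b : seq V), w = \sum_(v <- b) v /\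
     forall v, v \in b -> exists Lam, weight_vector Lam v) /\
  (forall (Lams : seq 'Hom(htilde, F^o)) (w : 'Hom(htilde, F^o) -> V),
     uniq Lams -> (forall Lam, Lam \in Lams -> weight_vector Lam (w Lam)) ->
     \sum_(Lam <- Lams) w Lam = 0 -> forall Lam, Lam \in Lams -> w Lam = 0).

Definition locally_nilpotent (X : toroidal) : Prop :=
  forall w, W w -> exists p, iter p (act X) w = 0.

Definition integrable : Prop :=
  direct_sum_of_weight_spaces /\
  forall k (alpha : dual F h0) x, alpha != 0 ->
    root_vector br (gk sigma xi k) alpha x ->
    locally_nilpotent (elt_loop k x).

Definition finite_dim_weight_spaces : Prop :=
  forall Lam, exists b : seq V, forall w, weight_vector Lam w ->
    exists c : 'I_(size b) -> F, w = \sum_i c i *: b`_i.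

Definition level_zero : Prop :=
  forall (i : 'I_n) w, W w -> act (elt_K 0 (delta_mx 0 i)) w = 0.

Definition nontrivial_loop_action : Prop :=
  exists k x w, [/\ x \in gk sigma xi k, W w & act (elt_loop k x) w != 0].

End Cartan.

Section TensorModule.
Variables (p : nat) (eta : 'M[F]_n -> 'M[F]_p) (beta : 'rV[F]_n).
Variables (l : nat) (q : 'I_l -> nat) (rho : forall i, g -> 'M[F]_(q i)).
Variables (N : nat) (s : 'I_N -> 'I_l) (a : 'I_N -> 'rV[F]_n).

Local Notation Q := (\sum_(nu < N) q (s nu))%N.

(* V_1 (x) V_2 (x) A, with V_1 (x) V_2 = 'M_(p, Q) through
   v1 (x) v2 = v1 *m v2^T; thus A (x) B acts as M |-> A *m M *m B^T. *)
Definition tensorA := finfam (Zn n) 'M[F]_(p, Q).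

Definition pure (v1 : 'cV[F]_p) (v2 : 'cV[F]_Q) (k : Zn n) : tensorA :=
  single k (v1 *m v2^T).

(* The linear extension of the action of x t^l (x in g_l), t^r d_i and t^r K_i;
   see tensor_act_loop, tensor_act_d and tensor_act_K. *)
Definition tensor_act (X : toroidal) (w : tensorA) : tensorA :=
  let: (f, z, d) := X in
  \sum_(k <- finsupp w)
    (\sum_(j <- finsupp f)
       single (k + j) (w k *m (twisted_op rho s a j (f j))^T) +
     \sum_(r <- finsupp d)
       single (k + r) (dot (d r) (intv k + beta) *: w k +
         \sum_i \sum_j (d r 0 i * intv r 0 j) *: (eta (delta_mx j i) *m w k))).

(* A tensor lies in V_1 (x) M exactly when all its rows lie in M. *)
Definition Vprime (gr : quotG m -> {vspace 'cV[F]_Q}) (w : tensorA) : Prop :=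
  forall k i, (row i (w k))^T \in gr (Gclass m k).

Lemma tensor_act_loop j x v1 v2 k : (forall i, rho i 0 = 0) ->
  tensor_act (elt_loop j x) (pure v1 v2 k) =
  pure v1 (twisted_op rho s a j x *m v2) (k + j).
Proof.
move=> rho0; have op0 i : twisted_op rho s a i 0 = 0.
  by rewrite /twisted_op -mxdiag0; apply/eq_mxdiag => nu; rewrite rho0 scaler0.
rewrite /tensor_act /elt_loop /pure.
under eq_bigr => k' _ do rewrite finsupp0 big_seq_fset0 addr0.
rewrite (@big_single _ _ _ (fun k' w => \sum_(j' <- _)
  single (k' + j') (w *m (twisted_op rho s a j' (single j x j'))^T))); last first.
  by apply: big1 => i _; rewrite mul0mx single0.
rewrite (@big_single _ _ _ (fun j' x' =>
  single (k + j') (v1 *m v2^T *m (twisted_op rho s a j' x')^T))).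
  by rewrite -mulmxA -trmx_mul.
by rewrite op0 trmx0 mulmx0 single0.
Qed.

Lemma tensor_act_d r i v1 v2 k :
  tensor_act (elt_d r (delta_mx 0 i)) (pure v1 v2 k) =
  ((k 0 i)%:~R + beta 0 i) *: pure v1 v2 (k + r) +
  \sum_j (r 0 j)%:~R *: pure (eta (delta_mx j i) *m v1) v2 (k + r).
Proof.
rewrite /tensor_act /elt_d /pure.
pose D r' u k' (w : 'M[F]_(p, Q)) : 'M[F]_(p, Q) :=
  dot u (intv k' + beta) *: w +
  \sum_i' \sum_j (u 0 i' * intv r' 0 j) *: (eta (delta_mx j i') *m w).
have D0u r' k' w : D r' 0 k' w = 0.
  rewrite /D dot0l scale0r add0r; apply: big1 => i' _; apply: big1 => j _.
  by rewrite mxE mul0r scale0r.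
have D0w r' u k' : D r' u k' 0 = 0.
  rewrite /D scaler0 add0r; apply: big1 => i' _; apply: big1 => j _.
  by rewrite mulmx0 scaler0.
under eq_bigr => k' _ do rewrite finsupp0 big_seq_fset0 add0r.
rewrite (@big_single _ _ _ (fun k' w => \sum_(r' <- _)
  single (k' + r') (D r' (single r (delta_mx 0 i) r') k' w))); last first.
  by apply: big1 => r' _; rewrite D0w single0.
rewrite (@big_single _ _ _ (fun r' u =>
  single (k + r') (D r' u k (v1 *m v2^T)))); last by rewrite D0u single0.
have dotd v : dot (delta_mx 0 i) v = v 0 i.
  rewrite /dot (bigD1 i) //= mxE !eqxx mul1r big1 ?addr0 // => i' ni.
  by rewrite mxE (negPf ni) mul0r.
rewrite singleD singleZ dotd !mxE; congr (_ + _).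
rewrite (bigD1 i) //= [X in single _ (_ + X)](_ : _ = 0) ?addr0; last first.
  apply: big1 => i' ni; apply: big1 => j _.
  by rewrite mxE (negPf ni) mul0r scale0r.
rewrite single_sum; apply: eq_bigr => j _.
by rewrite singleZ !mxE !eqxx mul1r mulmxA.
Qed.

Lemma tensor_act_K r u w : tensor_act (elt_K r u) w = 0.
Proof.
rewrite /tensor_act /elt_K !finsupp0 big1 // => k _.
by rewrite !big_seq_fset0 addr0.
Qed.

End TensorModule.
End Toroidal.

Arguments tensor_act {F n g p} eta beta {l q} rho {N} s a X w.

(* Main.v *)
(* Let U be a non-zero submodule of V'. The d_i act with distinct characters on
   the spaces attached to distinct powers t^k, so U is spanned by elements
   M t^k with M in V_1 (x) V_2. Graded irreducibility of V_2, on which g acts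
   non-trivially, puts the identity of V_2 in the degree 0 part of the
   non-unital algebra generated by the image of g. For r in Gamma, acting
   through g (x) t^r instead of g then shows that U is stable under
   multiplication by t^r. Comparing M t^(k+r) with the action of t^r d_i, U is
   stable under gl_n. By Burnside's theorem on V_1, U contains a pure tensor
   v_1 (x) v_2 t^k, hence all of V_1 (x) v_2 t^k, and the v_2 such that
   V_1 (x) v_2 t^k lies in U form a graded g-submodule of V_2.
   Weights: V(lam) is the sum of its eigenspaces for each u in h, as this sum is
   a submodule containing the highest weight vector; so the commuting elements
   of h_0 are simultaneously diagonalizable on V_2. If [u, x] = alpha(u) x with
   alpha(u) <> 0, the powers of x are eigenvectors of ad u with distinct
   eigenvalues, so that x acts nilpotently. *)

Require Import Defs.
From HB Require Import structures.
From mathcomp Require Import all_boot all_order all_algebra.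
From mathcomp Require Import finmap boolp.
From mathcomp Require Import reals complex ring.

Set Implicit Arguments.
Unset Strict Implicit.
Unset Printing Implicit Defensive.

Import GRing.Theory.

Local Open Scope ring_scope.

(** * Subspaces and eigenvectors *)

Section Subspaces.
Variables (F : fieldType) (V : lmodType F) (U : V -> Prop).
Hypothesis sU : subspace U.

Lemma subspace0 : U 0. Proof. by case: sU. Qed.

Lemma subspaceD u v : U u -> U v -> U (u + v).
Proof. by case: sU => _ UD Uu Uv; rewrite -[u]scale1r; apply: UD. Qed.

Lemma subspaceZ c u : U u -> U (c *: u).
Proof.
by case: sU => U0 UD Uu; rewrite -[c *: u]addr0; apply: UD.
Qed.

Lemma subspaceB u v : U u -> U v -> U (u - v).
Proof.
by move=> Uu Uv; rewrite -scaleN1r; apply: subspaceD => //; apply: subspaceZ.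
Qed.

Lemma subspaceZK c u : c != 0 -> U (c *: u) -> U u.
Proof. by move=> c0 /(subspaceZ c^-1); rewrite scalerA mulVf // scale1r. Qed.

Lemma subspace_sum (J : Type) (r : seq J) (P : pred J) (E : J -> V) :
  (forall j, P j -> U (E j)) -> U (\sum_(j <- r | P j) E j).
Proof.
by move=> UE; apply: (big_ind U); [exact: subspace0 | exact: subspaceD |].
Qed.

Lemma subspace_sum_seq (J : eqType) (r : seq J) (E : J -> V) :
  (forall j, j \in r -> U (E j)) -> U (\sum_(j <- r) E j).
Proof.
by move=> UE; rewrite big_seq; apply: subspace_sum.
Qed.

End Subspaces.

Lemma subspace_zero (F : fieldType) (V : lmodType F) :
  subspace (fun v : V => v = 0).
Proof. by split=> // c u v -> ->; rewrite scaler0 addr0. Qed.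

(** A subspace of maximal dimension among those inside [W] contains every [v] of [W], since adding
    the line of [v] cannot raise the dimension. It turns predicates into [{vspace V}], the form in
    which irreducibility is assumed. *)
Lemma subspace_vspace (F : fieldType) (V : vectType F) (W : V -> Prop) :
  subspace W -> exists U : {vspace V}, forall v, W v <-> v \in U.
Proof.
move=> sW; pose P d := `[< exists2 U : {vspace V}, \dim U = d &
  forall v, v \in U -> W v >].
have exP : exists d, P d.
  exists 0%N; apply/asboolP; exists 0%VS; first exact: dimv0.
  by move=> v; rewrite memv0 => /eqP->; apply: subspace0 sW.
have ubP d : P d -> (d <= \dim {:V})%N.
  by move=> /asboolP[U <- _]; apply/dimvS/subvf.
case: (ex_maxnP exP ubP) => d /asboolP[U dU UW] max_d.
exists U => v; split; last exact: UW.
move=> Wv; have UvW w : w \in (U + <[v]>)%VS -> W w.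
  case/memv_addP=> u Uu [_ /vlineP[c ->] ->].
  by apply: subspaceD => //; [apply: UW | apply: subspaceZ].
have: (\dim (U + <[v]>) <= d)%N.
  by apply: max_d; apply/asboolP; exists (U + <[v]>)%VS.
rewrite -dU => dimUv; have /eqP-> : U == (U + <[v]>)%VS.
  by rewrite eqEdim dimUv addvSl.
by apply: (subvP (addvSr _ _)); apply: memv_line.
Qed.

Section LinearFunctions.
Variables (F : fieldType) (V W : lmodType F).

(** A predicate on bare functions: the operators below are sums over finite supports and partial
    applications, without packaged linear structure. *)
Definition lin (D : V -> W) := forall c u v, D (c *: u + v) = c *: D u + D v.

Lemma lin0 D : lin D -> D 0 = 0.
Proof. by move=> /(_ (-1) 0 0); rewrite scaler0 addr0 scaleN1r addNr. Qed.

Lemma linD D u v : lin D -> D (u + v) = D u + D v.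
Proof. by move=> linD; rewrite -[u]scale1r linD !scale1r. Qed.

Lemma linZ D c u : lin D -> D (c *: u) = c *: D u.
Proof. by move=> linD; rewrite -[c *: u]addr0 linD lin0 // addr0. Qed.

Lemma lin_sum D (J : Type) (r : seq J) (P : pred J) (E : J -> V) : lin D ->
  D (\sum_(j <- r | P j) E j) = \sum_(j <- r | P j) D (E j).
Proof.
by move=> lD; apply: (big_morph D) => [u v|]; [apply: linD | apply: lin0].
Qed.

Lemma lin_bigsum (J : Type) (r : seq J) (D : J -> V -> W) :
  (forall j, lin (D j)) -> lin (fun v => \sum_(j <- r) D j v).
Proof.
move=> lD c u v; rewrite scaler_sumr -big_split.
by apply: eq_bigr => j _; apply: lD.
Qed.

Lemma lin_add D D' : lin D -> lin D' -> lin (fun v => D v + D' v).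
Proof. by move=> lD lD' c u v; rewrite lD lD' scalerDr addrACA. Qed.

Lemma lin_sub D D' : lin D -> lin D' -> lin (fun v => D v - D' v).
Proof.
by move=> lD lD' c u v; rewrite lD lD' scalerBr opprD addrACA.
Qed.

End LinearFunctions.

Lemma lin_scale (F : fieldType) (V : lmodType F) (e : F) :
  lin (fun v : V => e *: v).
Proof. by move=> c u v; rewrite scalerDr !scalerA mulrC. Qed.

Lemma lin_comp (F : fieldType) (U V W : lmodType F) (D : V -> W) (E : U -> V) :
  lin D -> lin E -> lin (fun u => D (E u)).
Proof. by move=> lD lE c u v; rewrite lE lD. Qed.

Section Eigen.
Variables (F : fieldType) (V : lmodType F).

(** Components of an element of a stable subspace along distinct characters lie in the subspace.
    With [U] the zero subspace this is linear independence. *)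
Lemma eigen_separation (I : Type) (J : eqType) (D : I -> V -> V)
    (chi : J -> I -> F) (U : V -> Prop) (s : seq J) (v : J -> V) :
    (forall i, lin (D i)) -> subspace U -> (forall i u, U u -> U (D i u)) ->
    uniq s -> (forall j i, j \in s -> D i (v j) = chi j i *: v j) ->
    {in s &, forall j j', j != j' -> exists i, chi j i != chi j' i} ->
    U (\sum_(j <- s) v j) -> forall j, j \in s -> U (v j).
Proof.
move=> lD sU stU; elim: s v => [//|j0 s IHs] v /= /andP[j0s us] Dv sep.
rewrite big_cons => Usum.
have Us j : j \in s -> U (v j).
  move=> js; have neq : j != j0 by apply: contraNneq j0s => <-.
  have [|| i neqi] := sep j j0 _ _ neq; rewrite ?mem_head ?in_cons ?js ?orbT //.
  apply: (subspaceZK sU (c := chi j i - chi j0 i)); first by rewrite subr_eq0.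
  (* [D i - chi j0 i] kills the [j0] term and multiplies the others by scalars, non-zero at [j]; the
     induction applies to this rescaled family. *)
  apply: (IHs (fun j => (chi j i - chi j0 i) *: v j)) js => //.
  - move=> j' i' j's.
    by rewrite (linZ _ _ (lD _)) Dv ?in_cons ?j's ?orbT // !scalerA mulrC.
  - by move=> j1 j2 j1s j2s; apply: sep; rewrite in_cons ?j1s ?j2s orbT.
  have := subspaceB sU (stU i _ Usum) (subspaceZ sU (chi j0 i) Usum).
  rewrite (linD _ _ (lD i)) (lin_sum _ _ _ (lD i)) Dv ?mem_head // scalerDr.
  rewrite opprD addrACA subrr add0r scaler_sumr -sumrB.
  congr U; rewrite big_seq [RHS]big_seq; apply: eq_bigr => j' j's.
  by rewrite Dv ?in_cons ?j's ?orbT // scalerBl.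
move=> j; rewrite in_cons => /orP[/eqP->|]; last exact: Us.
have := subspaceB sU Usum (subspace_sum_seq sU Us).
by rewrite addrK.
Qed.

(** [sum_of (eigen D) w] for all [w] is diagonalizability of [D], stated without a basis. *)
Definition sum_of (P : V -> Prop) (w : V) : Prop :=
  exists2 b : seq V, w = \sum_(v <- b) v & forall v, v \in b -> P v.

Lemma sum_of0 P : sum_of P 0.
Proof. by exists [::]; rewrite ?big_nil. Qed.

Lemma sum_of1 (P : V -> Prop) v : P v -> sum_of P v.
Proof.
by exists [:: v] => [|u]; rewrite ?big_seq1 // inE => /eqP->.
Qed.

Lemma sum_ofD P u v : sum_of P u -> sum_of P v -> sum_of P (u + v).
Proof.
move=> [b -> bP] [b' -> b'P]; exists (b ++ b'); first by rewrite big_cat.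
by move=> w; rewrite mem_cat => /orP[]; [apply: bP | apply: b'P].
Qed.

Lemma sum_of_sum P (J : eqType) (r : seq J) (E : J -> V) :
  (forall j, j \in r -> sum_of P (E j)) -> sum_of P (\sum_(j <- r) E j).
Proof.
move=> PE; rewrite big_seq; apply: (big_ind (sum_of P)) => //.
  exact: sum_of0.
exact: sum_ofD.
Qed.

Lemma sum_of_bind P Q w :
  (forall v, P v -> sum_of Q v) -> sum_of P w -> sum_of Q w.
Proof. by move=> PQ [b -> bP]; apply: sum_of_sum => v /bP/PQ. Qed.

Definition eigen (D : V -> V) (v : V) : Prop := exists c, D v = c *: v.

(** A diagonalizable operator stays diagonalizable on a stable subspace: once the summands are
    grouped by eigenvalue, the eigenvalues are distinct and [eigen_separation] puts each group in
    [U]. *)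
Lemma sum_of_eigen_stable D (U : V -> Prop) v : lin D -> subspace U ->
  (forall u, U u -> U (D u)) -> sum_of (eigen D) v -> U v ->
  sum_of (fun u => U u /\ eigen D u) v.
Proof.
move=> lD sU stU [b vE bE] Uv.
have /boolp.choice[c cE] : forall u, exists c, u \in b -> D u = c *: u.
  move=> u; case: (boolP (u \in b)) => [/bE[c Du]|_]; last by exists 0.
  by exists c.
pose x e := \sum_(u <- b | c u == e) u.
have Dx e : D (x e) = e *: x e.
  rewrite (lin_sum _ _ _ lD) scaler_sumr big_seq_cond [RHS]big_seq_cond.
  by apply: eq_bigr => u /andP[/cE-> /eqP->].
have vx : v = \sum_(e <- undup (map c b)) x e.
  rewrite vE /x; under [RHS]eq_bigr do rewrite big_mkcond.
  rewrite exchange_big big_seq [RHS]big_seq; apply: eq_bigr => u bu.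
  rewrite (bigD1_seq (c u)) ?undup_uniq //= ?mem_undup ?map_f // eqxx.
  by rewrite big1 ?addr0 // => e /negPf; rewrite eq_sym => ->.
rewrite vx; apply: sum_of_sum => e es; apply: sum_of1; split; last by exists e.
apply: (@eigen_separation unit _ (fun=> D) (fun e _ => e) U _ x
  _ sU _ _ _ _ _ e es).
- by [].
- by [].
- exact: undup_uniq.
- by move=> *; rewrite Dx.
- by move=> *; exists tt.
- by rewrite -vx.
Qed.

(** Induction on [s]. The subspace [U] is quantified after the operators so that the induction
    hypothesis can be applied to an eigenspace of [D i] in [U], stable under the other operators by
    commutation. *)
Lemma joint_eigen (I : eqType) (D : I -> V -> V) (s : seq I) :
  (forall i, lin (D i)) -> (forall i j v, D i (D j v) = D j (D i v)) ->
  (forall i v, i \in s -> sum_of (eigen (D i)) v) ->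
  forall U : V -> Prop, subspace U -> (forall i u, U u -> U (D i u)) ->
  forall v, U v ->
  sum_of (fun u => U u /\ forall i, i \in s -> eigen (D i) u) v.
Proof.
move=> lD cD; elim: s => [|i s IHs] diag U sU stU v Uv.
  by apply: sum_of1.
have /(sum_of_eigen_stable (lD i) sU (stU i))/(_ Uv) := diag i v (mem_head _ _).
apply: sum_of_bind => u [Uu [c Du]].
have diag' j w : j \in s -> sum_of (eigen (D j)) w.
  by move=> js; apply: diag; rewrite in_cons js orbT.
have sU' : subspace (fun u => U u /\ D i u = c *: u).
  split; first by rewrite lin0 // scaler0; split=> //; apply: subspace0 sU.
  move=> e x y [Ux Dx] [Uy Dy]; split; first by case: sU => _; apply.
  by rewrite lD Dx Dy scalerDr !scalerA mulrC.
have stU' j w : U w /\ D i w = c *: w -> U (D j w) /\ D i (D j w) = c *: D j w.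
  by case=> Uw Dw; split; [apply: stU | rewrite cD Dw linZ].
have := IHs diag' _ sU' stU' u (conj Uu Du).
apply: sum_of_bind => w [[Uw Dw] ew]; apply: sum_of1; split=> // j.
by rewrite in_cons => /orP[/eqP->|/ew//]; exists c.
Qed.

End Eigen.

(** * The grading of g by G *)

Section QuotClass.
Variables (n : nat) (m : 'I_n -> nat).
Hypothesis m_gt0 : forall i, (0 < m i)%N.

Lemma GrepGclassE (k : Zn n) i :
  Grep (Gclass m k) 0 i = (k 0%R i %% (m i)%:Z)%Z.
Proof.
have m0 : (m i)%:Z != 0 by rewrite eqz_nat -lt0n.
rewrite mxE ffunE /= prednK // modn_small;
  first by rewrite gez0_abs // modz_ge0.
by rewrite -ltz_nat gez0_abs ?modz_ge0 // -{2}(absz_nat (m i)) ltz_mod.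
Qed.

Lemma GrepK (b : quotG m) : Gclass m (Grep b) = b.
Proof.
apply/ffunP => i; rewrite ffunE mxE; apply: val_inj => /=.
have bm : (b i < m i)%N by rewrite -{2}(prednK (m_gt0 i)).
by rewrite modz_nat absz_nat modn_small modn_small // prednK.
Qed.

Lemma eq_Gclass (k l : Zn n) :
  (Gclass m k = Gclass m l) <-> forall i, (k 0%R i = l 0%R i %[mod m i])%Z.
Proof.
split=> [kl i|kl]; first by rewrite -!GrepGclassE kl.
rewrite -[LHS]GrepK -[RHS]GrepK; congr Gclass; apply/rowP => i.
by rewrite !GrepGclassE.
Qed.

Lemma GclassD (k l : Zn n) : Gclass m (k + l) = Gclass m k + Gclass m l.
Proof.
rewrite -[RHS]GrepK; apply/eq_Gclass => i.
rewrite !mxE !ffunE /= !prednK //.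
have abs (x : int) : (`|(x %% (m i)%:Z)%Z|%N : int) = (x %% (m i)%:Z)%Z.
  by rewrite gez0_abs // modz_ge0 // eqz_nat -lt0n.
by rewrite -modz_nat modz_mod PoszD -!modz_nat !abs !modz_mod modzDm.
Qed.

Lemma Gclass_Gamma (r : Zn n) : Gamma m r -> Gclass m r = 0.
Proof.
move=> mr; apply/ffunP => i; rewrite !ffunE; apply: val_inj => /=.
by have /dvdz_mod0P -> := mr i; rewrite mod0n.
Qed.

Lemma Gclass0 : Gclass m 0 = 0.
Proof. by apply: Gclass_Gamma => i; rewrite mxE dvdz0. Qed.

Lemma GclassB (k l : Zn n) : Gclass m (k - l) = Gclass m k - Gclass m l.
Proof. by apply: (addIr (Gclass m l)); rewrite -GclassD !subrK. Qed.

End QuotClass.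

Lemma exprz_mod (F : fieldType) (x : F) (d : nat) (e e' : int) :
  (0 < d)%N -> x ^+ d = 1 -> (e = e' %[mod d])%Z -> x ^ e = x ^ e'.
Proof.
move=> d0 xd ee'; have xdz : x ^ d%:Z = 1 by [].
have x0 : x != 0.
  by apply: contra_eq_neq xd => ->; rewrite expr0n gtn_eqF // eq_sym oner_eq0.
have modE (f : int) : x ^ f = x ^ (f %% d)%Z.
  by rewrite {1}(divz_eq f d) expfzDr // [(_ %/ _)%Z * _]mulrC -exprz_exp xdz
    exp1rz mul1r.
by rewrite modE ee' -modE.
Qed.

Section Multiloop.
Variables (F : fieldType) (g : vectType F) (br : g -> g -> g).
Variables (n : nat) (m : 'I_n -> nat).
Variables (sigma : 'I_n -> 'End(g)) (xi : 'I_n -> F).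
Hypothesis hsigma : multiloop_data br m sigma xi.

Lemma multiloop_gt0 i : (0 < m i)%N.
Proof. by have [_ _ /(_ i)[]] := hsigma. Qed.
Local Notation m_gt0 := multiloop_gt0.

Lemma gkP (k : Zn n) x :
  reflect (forall i, sigma i x = xi i ^ k 0 i *: x) (x \in gk sigma xi k).
Proof.
have inE i : (x \in passmx.leigenspace (sigma i) (xi i ^ k 0 i)) =
    (sigma i x == xi i ^ k 0 i *: x).
  by rewrite memv_ker add_lfunE opp_lfunE scale_lfunE id_lfunE subr_eq0.
rewrite /gk; apply: (iffP idP) => [xk i|xk].
  by apply/eqP; rewrite -inE; move: xk; apply: subvP; apply: (bigcapv_inf i).
rewrite memvE; apply/subv_bigcapP => i _; rewrite -memvE inE.
exact/eqP.
Qed.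

Lemma eq_gk (k l : Zn n) :
  Gclass m k = Gclass m l -> gk sigma xi k = gk sigma xi l.
Proof.
move=> /(eq_Gclass m_gt0) kl; apply/vspaceP => x.
have xikl i : xi i ^ k 0 i = xi i ^ l 0 i.
  have [_ _ _ /(_ i) pxi] := hsigma.
  exact: exprz_mod (m_gt0 i) (prim_expr_order pxi) (kl i).
by apply/gkP/gkP => xk i; rewrite xk xikl.
Qed.

Lemma gk_class k : gk sigma xi k = gk sigma xi (Grep (Gclass m k)).
Proof. by apply: eq_gk; rewrite GrepK //; apply: m_gt0. Qed.

(** Distinct classes give distinct characters: the representatives lie in [[0, m i)], where powers
    of the primitive root [xi i] determine the exponent. *)
Lemma directv_gk : directv (\sum_(b : quotG m) gk sigma xi (Grep b))%VS.
Proof.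
apply/directv_sum_independent => us us_gk sum0 b _.
refine (@eigen_separation F g 'I_n _ (fun i x => sigma i x)
  (fun (b : quotG m) i => xi i ^ Grep b 0 i) (fun v => v = 0)
  (index_enum (quotG m)) us _ _ _ _ _ _ sum0 b _).
- by move=> i e u v; rewrite linearP.
- exact: subspace_zero.
- by move=> i u ->; rewrite linear0.
- exact: index_enum_uniq.
- by move=> b' i _; have /gkP := us_gk b' isT.
- move=> b1 b2 _ _ neqb.
  have [[i /eqP neqi]|neqi] := pselect (exists i, b1 i <> b2 i).
    exists i; rewrite !mxE -!exprnP.
    have [_ _ _ /(_ i) pxi] := hsigma.
    rewrite (eq_prim_root_expr pxi) !modn_small //;
      by rewrite -[X in (_ < X)%N](prednK (m_gt0 i)).
  case/eqP: neqb; apply/ffunP => i; apply: contrapT => neqi'; apply: neqi.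
  by exists i.
- by rewrite mem_index_enum.
Qed.

(** Discrete Fourier decomposition: [y k] averages the [z ^+ (k * j) *: D^j x] and has eigenvalue
    [z ^- k]; the [y k] add up to [x] because the powers of a root of unity other than 1 sum to
    0. *)
Lemma unity_diag (D : g -> g) d (z : F) (x : g) :
  (0 < d)%N -> d.-primitive_root z ->
  lin D -> iter d D x = x -> sum_of (eigen D) x.
Proof.
move=> d0 pz lD Dx; have z0 : z != 0 by rewrite (prim_root_eq0 pz) -lt0n.
pose y (k : 'I_d) := d%:R^-1 *: \sum_(0 <= j < d) (z ^+ (k * j)) *: iter j D x.
have -> : x = \sum_k y k.
  rewrite /y -scaler_sumr exchange_big /= big_mkord.
  rewrite (bigD1 (Ordinal d0)) //= [X in _ + X]big1 => [|j j0]; last first.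
    rewrite -scaler_suml; apply/eqP; rewrite scaler_eq0; apply/orP; left.
    have zj : z ^+ j != 1.
      apply: contra j0 => /eqP zj1.
      have := prim_order_dvd pz j; rewrite zj1 eqxx => dj.
      apply/eqP/val_inj => /=; apply/eqP; rewrite -leqn0 leqNgt;
        apply/negP => j_gt0.
      by have := dvdn_leq j_gt0 dj; rewrite leqNgt ltn_ord.
    have : (z ^+ j - 1) * (\sum_(i < d) z ^+ (i * j)) = 0.
      under eq_bigr do rewrite mulnC exprM.
      by rewrite -subrX1 -exprM mulnC exprM (prim_expr_order pz) expr1n subrr.
    by move=> /eqP; rewrite mulf_eq0 subr_eq0 (negPf zj).
  rewrite addr0; under eq_bigr do rewrite muln0 expr0 scale1r.
  by rewrite sumr_const card_ord -scaler_nat scalerA mulVf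
    ?(prim_root_natf_neq0 pz) // scale1r.
apply: sum_of_sum => k _; apply: sum_of1; exists (z ^- k).
apply: (scalerI (a := z ^+ k)); first by rewrite expf_neq0.
rewrite !scalerA mulfV ?expf_neq0 // mul1r.
rewrite /y (linZ _ _ lD) (lin_sum _ _ _ lD) scalerA mulrC -scalerA;
  congr (_ *: _).
rewrite scaler_sumr; under eq_bigr do rewrite (linZ _ _ lD) scalerA -exprD
  -mulnS.
(* Applying [z ^+ k *: D] shifts the index range to 1..d, and the new term at d equals the lost term
   at 0. *)
rewrite -(big_add1 _ _ 0 d.+1 xpredT (fun j => z ^+ (k * j) *: iter j D x)).
by rewrite big_nat_recr //= [RHS]big_ltn // Dx mulnC exprM (prim_expr_order pz)
  expr1n muln0 expr0 addrC.
Qed.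

(** The commuting [sigma i] are jointly diagonalizable by [unity_diag]; an eigenvalue of [sigma i]
    is an [m i]-th root of unity, hence a power of [xi i], so joint eigenvectors are homogeneous. *)
Lemma gk_span (x : g) : x \in (\sum_(b : quotG m) gk sigma xi (Grep b))%VS.
Proof.
have [_ csigma osigma pxi] := hsigma.
have lD i : lin (sigma i) by move=> c u v; rewrite linearP.
have cD i j v : sigma i (sigma j v) = sigma j (sigma i v).
  by rewrite -!comp_lfunE csigma.
have diag i v : i \in enum 'I_n -> sum_of (eigen (sigma i)) v.
  move=> _; have [di idi _] := osigma i.
  by apply: (unity_diag di (pxi i) (lD i)).
have [] := joint_eigen lD cD diag (U := fun=> True) _ _ (v := x) I.
- by split.
- by [].
move=> b -> bE; rewrite big_seq; apply: memv_suml => v /bE[_ ev].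
have [->|v0] := eqVneq v 0; first exact: mem0v.
have /boolp.choice[k kE] : forall i, exists k : nat, sigma i v = xi i ^+ k *: v.
  move=> i; have [c Dv] := ev i (mem_enum _ _).
  have iterD j : iter j (sigma i) v = c ^+ j *: v.
    by elim: j => [|j IHj];
      rewrite ?scale1r //= IHj linearZ /= Dv scalerA exprSr.
  have [_ idi _] := osigma i.
  have /eqP : c ^+ m i = 1.
    apply/eqP; rewrite -subr_eq0; have /eqP := idi v.
    by rewrite iterD -subr_eq0 -{2}[v]scale1r -scalerBl scaler_eq0 (negPf v0)
      orbF.
  by move=> cm; have [j cE] := prim_rootP (pxi i) (elimT eqP cm); exists j;
    rewrite Dv cE.
have vk : v \in gk sigma xi (\row_i (k i)%:Z) by apply/gkP => i; rewrite mxE kE.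
by rewrite gk_class in vk; apply: (subvP (sumv_sup _ (erefl _) (subvv _))) vk.
Qed.

Lemma gcomp_sum (x : g) : \sum_(b : quotG m) gcomp sigma xi b x = x.
Proof. exact: sumv_pi_sum (gk_span x). Qed.

Lemma gcomp_gk (b : quotG m) (x : g) :
  gcomp sigma xi b x \in gk sigma xi (Grep b).
Proof. exact: memv_sum_pi. Qed.

Lemma gcomp_id (k : Zn n) x (b : quotG m) : x \in gk sigma xi k ->
  gcomp sigma xi b x = if b == Gclass m k then x else 0.
Proof.
move=> xk.
have /directv_sum_unique/(_ (fun b => gcomp sigma xi b x)) := directv_gk.
move/(_ (fun b => if b == Gclass m k then x else 0)) => uniq_dec.
have : \sum_(b : quotG m) gcomp sigma xi b x =
    \sum_b if b == Gclass m k then x else 0.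
  by rewrite gcomp_sum -big_mkcond big_pred1_eq.
move/eqP; rewrite uniq_dec => [/forall_inP/(_ b isT)/eqP//|b' _|b' _].
  exact: gcomp_gk.
by case: eqP => [->|_]; rewrite ?mem0v // -gk_class.
Qed.

Lemma twist_aut1 (x : g) : twist_aut sigma xi (fun _ : quotG m => 1) x = x.
Proof.
rewrite /twist_aut sum_lfunE -[RHS]gcomp_sum; apply: eq_bigr => b _.
by rewrite scale_lfunE scale1r.
Qed.

End Multiloop.

(** * Matrices and representations *)

Section BlockDiagonal.
Variables (F : fieldType) (p : nat) (p_ : 'I_p -> nat).
Implicit Types A B : forall i, 'M[F]_(p_ i).

Lemma mul_mxdiag A B :
  \mxdiag_i A i *m \mxdiag_i B i = \mxdiag_i (A i *m B i).
Proof.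
rewrite {2 3}/mxdiag mul_mxdiag_mxblock; apply/eq_mxblock => i j.
by case: eqVneq => [->|_]; rewrite ?conform_mx_id ?mulmx0.
Qed.

Lemma scale_mxdiag c A : c *: \mxdiag_i A i = \mxdiag_i (c *: A i).
Proof.
rewrite -mul_scalar_mx -mxdiagZ mul_mxdiag.
by apply: eq_mxdiag => i; rewrite mul_scalar_mx.
Qed.

Lemma sum_of_eigen_mxdiag A :
  (forall i v, sum_of (eigen (mulmx (A i))) (v : 'cV_(p_ i))) ->
  forall v, sum_of (eigen (mulmx (\mxdiag_i A i))) (v : 'cV_(\sum_i p_ i)).
Proof.
(* [J i] is the inclusion of the i-th block; it intertwines [A i] with the block diagonal matrix. *)
move=> diag v; pose J i := submxrow (1%:M : 'M[F]_(\sum_i p_ i)) i.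
have mulJ i : \mxdiag_i A i *m J i = J i *m A i.
  suff /eq_mxrowP/(_ i) :
    \mxrow_i (\mxdiag_i A i *m J i) = \mxrow_i (J i *m A i) by [].
  by rewrite -mul_mxrow -mul_mxrow_mxdiag !submxrowK mulmx1 mul1mx.
have -> : v = \sum_i J i *m submxcol v i.
  by rewrite -mul_mxrow_mxcol submxrowK submxcolK mul1mx.
apply: sum_of_sum => i _; have [b -> bE] := diag i (submxcol v i).
rewrite mulmx_sumr; apply: sum_of_sum => w /bE[c Aw]; apply: sum_of1; exists c.
by rewrite mulmxA mulJ -mulmxA Aw scalemxAr.
Qed.

End BlockDiagonal.

Section HighestWeight.
Variables (F : fieldType) (g : vectType F) (br : g -> g -> g).
Variables (h : {vspace g}) (q : nat) (rho : g -> 'M[F]_q).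
Hypotheses (hh : cartan br fullv h) (rep : lie_rep br rho).

Lemma lie_rep0 : rho 0 = 0.
Proof.
by have [/(_ (-1) 0 0)] := rep; rewrite scaler0 addr0 scaleN1r addNr.
Qed.

Lemma lie_rep_sum (J : Type) (r : seq J) (P : pred J) (E : J -> g) :
  rho (\sum_(j <- r | P j) E j) = \sum_(j <- r | P j) rho (E j).
Proof.
apply: (big_morph rho) => [x y|]; last exact: lie_rep0.
by rewrite -[x]scale1r; case: rep => -> _; rewrite !scale1r.
Qed.

Lemma lie_repZ c x : rho (c *: x) = c *: rho x.
Proof. by case: rep => /(_ c x 0) + _; rewrite lie_rep0 !addr0. Qed.

(** The sum of the eigenspaces of [rho u] is a submodule, because g has a basis of eigenvectors of
    [ad u]; it contains the highest weight vector, so by irreducibility it is everything. *)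
Lemma sum_of_eigen_cartan (pos : dual F h -> Prop) (lam : dual F h) u :
  irreducible_rep rho -> highest_weight br rho fullv pos lam ->
  u \in h -> forall v, sum_of (eigen (mulmx (rho u))) (v : 'cV_q).
Proof.
case=> _ irr [v0 [v0_neq0 hv0 _]] uh.
have sE : subspace (sum_of (eigen (mulmx (rho u)) : 'cV_q -> Prop)).
  split=> [|c v w [b -> bE] sw]; first exact: sum_of0.
  apply: sum_ofD sw; rewrite scaler_sumr; apply: sum_of_sum => x /bE[e ex].
  apply: sum_of1; exists e.
  by rewrite linearZ /= ex !scalerA mulrC.
have [E EP] := subspace_vspace sE.
have invE : Defs.invariant rho E.
  have [_ _ _ /(_ u uh)[X Xbasis adX]] := hh.
  move=> x v /EP[b -> bE]; apply/EP; rewrite mulmx_sumr.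
  apply: sum_of_sum => w /bE[c cw].
  have := memvf x; rewrite -(span_basis Xbasis) => xX.
  rewrite (@coord_span _ _ _ (in_tuple X) _ xX).
  rewrite lie_rep_sum mulmx_suml /=; apply: sum_of_sum => i _.
  have [e ex] := adX _ (mem_nth 0 (ltn_ord i)).
  (* An eigenvector of [ad u] for [e] moves the eigenvalue [c] of [rho u] to [e + c]. *)
  apply: sum_of1; exists (e + c); rewrite lie_repZ -scalemxAl.
  rewrite -scalemxAr [RHS]scalerA mulrC -scalerA; congr (_ *: _).
  have := rep.2 u X`_i; rewrite ex lie_repZ => comm.
  have -> : rho u *m (rho X`_i *m w) = (e *: rho X`_i + rho X`_i *m rho u) *m w.
    by rewrite comm subrK mulmxA.
  by rewrite mulmxDl -mulmxA cw -scalemxAl -scalemxAr scalerDl.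
case: (irr E invE) => EE v; last by apply/EP; rewrite EE memvf.
have: v0 \in E.
  apply/EP; apply: sum_of1; exists (lam (vsproj h u)).
  by have := hv0 (vsproj h u); rewrite vsprojK.
by rewrite EE memv0 (negPf v0_neq0).
Qed.

End HighestWeight.

(** The j-th power of [B] is an eigenvector of [[A, -]] with eigenvalue [c *+ j]. These are
    distinct, so if no power vanished there would be [q * q + 1] independent matrices of size
    [q]. *)
Lemma commutator_nilpotent (F : fieldType) (q : nat) (A B : 'M[F]_q) (c : F) :
  (forall d : nat, (0 < d)%N -> d%:R != 0 :> F) -> c != 0 ->
  A *m B - B *m A = c *: B -> exists d, iter d (mulmx B) 1%:M = 0.
Proof.
move=> cF c0 AB; pose P j := iter j (mulmx B) 1%:M.
have comP j : A *m P j - P j *m A = (c *+ j) *: P j.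
  elim: j => [|j IHj]; first by rewrite mulmx1 mul1mx subrr scale0r.
  have -> : A *m P j.+1 - P j.+1 *m A =
      (A *m B - B *m A) *m P j + B *m (A *m P j - P j *m A).
    by rewrite mulmxBl mulmxBr !mulmxA addrA subrK.
  by rewrite AB IHj -scalemxAl -scalemxAr -scalerDl mulrS.
apply: contrapT => noP; pose d := (q * q)%N.
have P0 j : P j != 0 by apply/eqP => Pj; apply: noP; exists j.
have freeP : free (mktuple (fun j : 'I_d.+1 => P j)).
  apply/freeP => k ksum i.
  suff /eqP : k i *: P i = 0 by rewrite scaler_eq0 (negPf (P0 i)) orbF => /eqP.
  refine (@eigen_separation F _ unit _ (fun _ X => A *m X - X *m A)
    (fun (i : 'I_d.+1) _ => c *+ i) (fun v => v = 0) (index_enum 'I_d.+1)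
    (fun i => k i *: P i) _ (subspace_zero _) _ (index_enum_uniq _) _ _ _ i
    (mem_index_enum _)).
  - by move=> _ e X Y; rewrite mulmxDl mulmxDr -!scalemxAl -!scalemxAr scalerBr
    opprD addrACA.
  - by move=> _ X ->; rewrite mulmx0 mul0mx subrr.
  - by move=> j _ _; rewrite -scalemxAr -scalemxAl -scalerBr comP !scalerA
    mulrC.
  - move=> j j' _ _ neqj; exists tt.
    wlog lt_j : j j' neqj / (j < j')%N.
      move=> wl; have := neqj; rewrite -val_eqE neq_ltn => /orP[] lt_j.
        exact: wl.
      by rewrite eq_sym wl // eq_sym.
    rewrite eq_sym -subr_eq0 -mulrnBr 1?ltnW // -mulr_natr mulf_neq0 //.
    by rewrite cF // subn_gt0.
  - under eq_bigr do rewrite -(tnth_mktuple (fun j : 'I_d.+1 => P j)).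
    by under eq_bigr do rewrite (tnth_nth 0).
have := dim_span (mktuple (fun j : 'I_d.+1 => P j)).
have := dimvS (subvf <<mktuple (fun j : 'I_d.+1 => P j)>>%VS).
by rewrite (eqP freeP) size_tuple dimvf /= ltnn.
Qed.

Lemma col_inj (F : fieldType) p q (A B : 'M[F]_(p, q)) :
  (forall j, col j A = col j B) -> A = B.
Proof.
by move=> AB; apply/matrixP => i j; have /colP/(_ i) := AB j; rewrite !mxE.
Qed.

Lemma mulmx_cV_inj (F : fieldType) p q (A B : 'M[F]_(p, q)) :
  (forall v : 'cV_q, A *m v = B *m v) -> A = B.
Proof.
by move=> AB; apply: col_inj => j; rewrite !colE AB.
Qed.

(* Lomonosov and Rosenthal's proof: if T has minimal non-zero rank r > 1 and
   T x1, T x2 are independent, pick X with X T x1 = x2; then T X T - a T is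
   non-zero for every a, and of rank < r for an eigenvalue a of T X on im T. *)
Lemma burnside_rank1 (F : closedFieldType) p (A : 'M[F]_p -> Prop) :
  (0 < p)%N -> subspace A -> (forall X Y, A X -> A Y -> A (X *m Y)) ->
  A 1%:M -> (forall v w : 'cV_p, v != 0 -> exists2 X, A X & X *m v = w) ->
  exists2 T, A T & \rank T = 1%N.
Proof.
move=> p0 sA AM A1 tA.
pose P r := `[< exists2 T, A T /\ T != 0 & \rank T = r >].
have exP : exists r, P r.
  exists (\rank (1%:M : 'M[F]_p)); apply/asboolP; exists 1%:M => //; split=> //.
  by rewrite -mxrank_eq0 mxrank1 -lt0n.
case: (ex_minnP exP) => r /asboolP[T [AT T0] rT] min_r; exists T => //.
have r0 : (0 < r)%N by rewrite -rT lt0n mxrank_eq0.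
apply/eqP; rewrite eqn_leq rT r0 andbT leqNgt; apply/negP => r1.
have [x1 Tx1] : exists x1 : 'cV_p, T *m x1 != 0.
  apply: contrapT => noX; case/eqP: T0; apply: mulmx_cV_inj => v.
  by rewrite mul0mx; apply/eqP/negP => /negP Tv; apply: noX; exists v.
have [x2 Tx2] : exists x2 : 'cV_p, forall a, T *m x2 <> a *: (T *m x1).
  apply: contrapT => noX.
  (* Otherwise every column of [T] is a multiple of [T *m x1], and [T] has rank at most 1. *)
  have /boolp.choice[a Ta] : forall j, exists a, col j T = a *: (T *m x1).
    move=> j; apply: contrapT => noa; apply: noX; exists (delta_mx j 0) => a Ta.
    by apply: noa; exists a; rewrite -Ta colE.
  have TE : T = (T *m x1) *m \row_j a j.
    apply: col_inj => j; rewrite Ta; apply/colP => i.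
    by rewrite !mxE big_ord1 !mxE mulrC.
  have := mulmx_max_rank (T *m x1) (\row_j a j); rewrite -TE rT.
  by rewrite leqNgt r1.
have [X AX Xx1] := tA (T *m x1) x2 Tx1.
rewrite -rT in r0 *.
have [C [R CR]] : exists (C : 'M_(p, \rank T)) R, C *m R = T.
  by exists (col_base T), (row_base T); apply: mulmx_base.
(* The columns of [C] form a basis of the image of [T], and [T X C = C Y]: so [Y] is the matrix of
   [T X] on this image. *)
pose Y := R *m X *m C.
have /closed_rootP[a] : size (char_poly Y) != 1%N.
  by rewrite size_char_poly eqSS -lt0n.
rewrite -eigenvalue_root_char => eig.
have STE : T *m X *m T - a *: T = C *m (Y - a%:M) *m R.
  rewrite mulmxBr mulmxBl mul_mx_scalar -scalemxAl CR /Y.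
  by rewrite !mulmxA CR -(mulmxA _ C) CR.
have rY : (\rank (Y - a%:M)%R < \rank T)%N.
  rewrite ltn_neqAle rank_leq_row andbT; apply: contra eig => /eqP rY.
  by rewrite -mxrank_eq0 mxrank_ker rY subnn.
have ST0 : T *m X *m T - a *: T != 0.
  apply/eqP => ST0; apply: (Tx2 a); apply/eqP; rewrite -subr_eq0 -Xx1.
  by rewrite !mulmxA scalemxAl -mulmxBl ST0 mul0mx.
have rST : (\rank (T *m X *m T - a *: T)%R < \rank T)%N.
  rewrite STE; apply: leq_ltn_trans rY; apply: leq_trans (mxrankM_maxl _ _) _.
  exact: mxrankM_maxr.
have PST : P (\rank (T *m X *m T - a *: T)%R).
  apply/asboolP; exists (T *m X *m T - a *: T) => //; split=> //.
  by apply: subspaceB => //; [exact: AM (AM _ _ AT AX) AT | apply: subspaceZ].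
by have := min_r _ PST; rewrite leqNgt -rT rST.
Qed.

(** * The action on V_1 (x) V_2 (x) A *)

Section FiniteFamilies.
Variables (F : fieldType) (I : choiceType) (V W : lmodType F).

Lemma lin_single (i : I) : lin (@single I V i).
Proof. by move=> c u v; rewrite singleD singleZ. Qed.

Lemma singleB (i : I) (u v : V) : single i (u - v) = single i u - single i v.
Proof. by rewrite singleD -scaleN1r singleZ scaleN1r. Qed.

Lemma lin_coef (i : I) : lin (fun f : finfam I V => f i).
Proof. by move=> c f g; rewrite ff_addE ff_scaleE. Qed.

Lemma finfam_sum (f : finfam I V) : f = \sum_(i <- finsupp f) single i (f i).
Proof.
apply/fsfunP => i; rewrite (lin_sum _ _ _ (lin_coef i)).
case: (finsuppP f i) => [nfi|fi].
  rewrite big_seq big1 // => j fj; rewrite singleE.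
  by case: eqP => // ij; rewrite ij fj in nfi.
rewrite (bigD1_seq i) ?fset_uniq //= singleE eqxx big1 ?addr0 // => j.
by rewrite singleE eq_sym => /negPf->.
Qed.

Lemma lin_ext (f : finfam I V) (D D' : finfam I V -> W) : lin D -> lin D' ->
  (forall i, i \in finsupp f -> D (single i (f i)) = D' (single i (f i))) ->
  D f = D' f.
Proof.
move=> lD lD' DD'; rewrite [f]finfam_sum !lin_sum // big_seq [RHS]big_seq.
exact: eq_bigr.
Qed.

Lemma lin_finsupp (T : I -> V -> W) : (forall i, lin (T i)) ->
  lin (fun f : finfam I V => \sum_(i <- finsupp f) T i (f i)).
Proof.
move=> lT c f g.
(* The three supports differ, so all sums are extended to [S], where the extra terms are
   [T i 0 = 0]. *)
pose S := (finsupp f `|` finsupp g)%fset.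
have widen (f' : finfam I V) : {subset finsupp f' <= S} ->
    \sum_(i <- finsupp f') T i (f' i) = \sum_(i <- S) T i (f' i).
  move=> sub; apply: big_fset_incl; first exact/fsubsetP.
  by move=> i _ /fsfun_dflt->; rewrite lin0.
rewrite !widen.
- rewrite scaler_sumr -big_split; apply: eq_bigr => i _ /=.
  by rewrite -lT; congr T; apply: lin_coef.
- by move=> i gi; rewrite inE gi orbT.
- by move=> i fi; rewrite inE fi.
move=> i; rewrite mem_finsupp ff_addE ff_scaleE inE => fgi.
apply: contraTT fgi; rewrite negb_or => /andP[/fsfun_dflt-> /fsfun_dflt->].
by rewrite scaler0 addr0 eqxx.
Qed.

End FiniteFamilies.

Section Convolution.
Variables (F : fieldType) (I J : choiceType) (V V' W : lmodType F).
Variable T : I -> J -> V -> V' -> W.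
Hypothesis linl : forall i j v', lin (T i j ^~ v').
Hypothesis linr : forall i j v, lin (T i j v).

(** Common form of the actions of the loop part and of the derivations, and of the brackets
    [loop_loop], [d_loop] and [d_d]; bilinearity and the values on [single] are thus proved once. *)
Definition conv (f : finfam I V) (f' : finfam J V') : W :=
  \sum_(i <- finsupp f) \sum_(j <- finsupp f') T i j (f i) (f' j).

Lemma lin_convl f' : lin (conv^~ f').
Proof.
pose T' i v := \sum_(j <- finsupp f') T i j v (f' j).
apply: (lin_finsupp (T := T')) => i.
exact: lin_bigsum.
Qed.

Lemma lin_convr f : lin (conv f).
Proof.
exact: (@lin_bigsum F (finfam J V') W I (finsupp f)
  (fun i (f' : finfam J V') => \sum_(j <- finsupp f') T i j (f i) (f' j))
  (fun i => lin_finsupp (fun j => linr i j (f i)))).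
Qed.

Lemma conv_single i j v v' : conv (single i v) (single j v') = T i j v v'.
Proof.
have T0l k k' v1 : T k k' 0 v1 = 0 by rewrite (lin0 (linl k k' v1)).
rewrite /conv.
rewrite (@big_single I V W
  (fun i u => \sum_(j' <- _) T i j' u (single j v' j'))).
  by rewrite (@big_single J V' W (fun j u => T i j v u)) // (lin0 (linr i j v)).
by rewrite big1.
Qed.

End Convolution.

(** Only degrees in the supports of [f] and [f'] have to be checked. This lets [der_act_loop] assume
    that the degree of a derivation lies in [Gamma]. *)
Lemma trilin_ext (F : fieldType) (I J K : choiceType) (U V V' W : lmodType F)
    (f : finfam I U) (f' : finfam J V) (w : finfam K V')
    (T T' : finfam I U -> finfam J V -> finfam K V' -> W) :
  (forall f' w, lin (fun f => T f f' w)) ->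
  (forall f w, lin (fun f' => T f f' w)) ->
  (forall f f', lin (T f f')) ->
  (forall f' w, lin (fun f => T' f f' w)) ->
  (forall f w, lin (fun f' => T' f f' w)) ->
  (forall f f', lin (T' f f')) ->
  (forall i u j v k v', i \in finsupp f -> j \in finsupp f' ->
    T (single i u) (single j v) (single k v') =
    T' (single i u) (single j v) (single k v')) ->
  T f f' w = T' f f' w.
Proof.
move=> l1 l2 l3 l1' l2' l3' TT'.
apply: (lin_ext (l1 f' w) (l1' f' w)) => i fi.
apply: (lin_ext (l2 _ w) (l2' _ w)) => j fj.
by apply: (lin_ext (l3 _ _) (l3' _ _)) => k _; apply: TT'.
Qed.

Section TensorAction.
Variables (F : numClosedFieldType) (n : nat).
Variables (g : vectType F) (br : g -> g -> g) (frm : g -> g -> F).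
Hypothesis hbr : lie_bracket br.
Variables (m : 'I_n -> nat) (sigma : 'I_n -> 'End(g)) (xi : 'I_n -> F).
Hypothesis hsigma : multiloop_data br m sigma xi.
Variables (p : nat) (eta : 'M[F]_n -> 'M[F]_p) (beta : 'rV[F]_n).
Hypothesis heta : lie_rep (@gl_bracket F n) eta.
Variables (l : nat) (q : 'I_l -> nat) (rho : forall i, g -> 'M[F]_(q i)).
Hypothesis hrho : forall i, lie_rep br (rho i).
Variables (N : nat) (s : 'I_N -> 'I_l) (a : 'I_N -> 'rV[F]_n).
Hypothesis ha : forall nu, torsion_point m (a nu).

Local Notation Q := (\sum_(nu < N) q (s nu))%N.
Local Notation op := (twisted_op rho s a).
Local Notation rep := (twisted_rep m sigma xi rho s a).
Local Notation tA := (finfam (Zn n) 'M[F]_(p, Q)).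
Local Notation act := (tensor_act eta beta rho s a).

Lemma torsion_neq0 nu i : a nu 0 i != 0.
Proof.
apply/eqP => a0; have /eqP := ha nu i.
by rewrite a0 expr0n gtn_eqF ?(multiloop_gt0 hsigma) // eq_sym oner_eq0.
Qed.

Lemma mpowD nu k j : mpow (a nu) (k + j) = mpow (a nu) k * mpow (a nu) j.
Proof.
rewrite /mpow -big_split; apply: eq_bigr => i _ /=.
by rewrite mxE expfzDr ?torsion_neq0.
Qed.

Lemma eq_mpow nu k j : Gclass m k = Gclass m j -> mpow (a nu) k = mpow (a nu) j.
Proof.
move/(eq_Gclass (multiloop_gt0 hsigma)) => kj; apply: eq_bigr => i _.
exact: exprz_mod (multiloop_gt0 hsigma i) (ha nu i) (kj i).
Qed.

Lemma mpow0 (b : 'rV[F]_n) : mpow b 0 = 1.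
Proof. by rewrite /mpow big1 // => i _; rewrite mxE expr0z. Qed.

Lemma eq_twisted_op k j : Gclass m k = Gclass m j -> op k =1 op j.
Proof.
by move=> kj x; apply: eq_mxdiag => nu; rewrite (eq_mpow nu kj).
Qed.

Lemma lin_twisted_op k : lin (op k).
Proof.
move=> c x y; rewrite /twisted_op scale_mxdiag -mxdiagD; apply: eq_mxdiag => nu.
by have [-> _] := hrho (s nu); rewrite scalerDr !scalerA mulrC.
Qed.

Lemma twisted_op_bracket k j x y :
  op (k + j) (br x y) = op k x *m op j y - op j y *m op k x.
Proof.
rewrite /twisted_op !mul_mxdiag -mxdiagB; apply: eq_mxdiag => nu.
have [_ ->] := hrho (s nu); rewrite scalerBr mpowD -!scalemxAl -!scalemxAr.
by rewrite !scalerA [X in _ - X *: _]mulrC.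
Qed.

(** Only the component of class [k] survives, and the scalars [mpow (a nu)] depend on the class
    alone because the [a nu] are torsion points. *)
Lemma twisted_rep_homogeneous k x : x \in gk sigma xi k -> rep x = op k x.
Proof.
move=> xk; rewrite /twisted_rep (bigD1 (Gclass m k)) //=.
rewrite [X in _ + X]big1 => [|b nb].
  rewrite addr0 (gcomp_id hsigma _ xk) eqxx; apply: eq_twisted_op.
  exact/GrepK/(multiloop_gt0 hsigma).
by rewrite (gcomp_id hsigma _ xk) (negPf nb) (lin0 (lin_twisted_op _)).
Qed.

Lemma twisted_rep_gcomp x : rep x = \sum_(b : quotG m) rep (gcomp sigma xi b x).
Proof.
apply: eq_bigr => b _.
by rewrite (@twisted_rep_homogeneous (Grep b)) // gcomp_gk.
Qed.

Definition loop_op (k j : Zn n) (M : 'M[F]_(p, Q)) (x : g) : tA :=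
  single (k + j) (M *m (op j x)^T).

(* \sum_i \sum_j u_i r_j E_ji is the rank one matrix r^T u. *)
Definition der_mx (r k : Zn n) (M : 'M[F]_(p, Q)) (u : 'rV[F]_n) :
    'M[F]_(p, Q) :=
  dot u (intv F k + beta) *: M + eta ((intv F r)^T *m u) *m M.

Definition der_op (k r : Zn n) (M : 'M[F]_(p, Q)) (u : 'rV[F]_n) : tA :=
  single (k + r) (der_mx r k M u).

Definition loop_act f w := conv loop_op w f.
Definition der_act d w := conv der_op w d.

Lemma act_split f z d w : act (f, z, d) w = loop_act f w + der_act d w.
Proof.
rewrite /tensor_act /loop_act /der_act /conv -big_split.
apply: eq_bigr => k _ /=.
congr (_ + _); apply: eq_bigr => r _; congr (single _ (_ + _)).
have -> : (intv F r)^T *m d r =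
    \sum_i \sum_j (d r 0 i * intv F r 0 j) *: delta_mx j i.
  rewrite exchange_big [LHS]matrix_sum_delta; apply: eq_bigr => j _.
  apply: eq_bigr => i _; congr (_ *: _).
  by rewrite mxE big_ord1 !mxE mulrC.
rewrite (lie_rep_sum heta) mulmx_suml; apply: eq_bigr => i _.
rewrite (lie_rep_sum heta) mulmx_suml; apply: eq_bigr => j _.
by rewrite (lie_repZ heta) scalemxAl.
Qed.

Lemma lin_loop_opl k j x : lin (loop_op k j ^~ x).
Proof.
by apply: lin_comp (lin_single _) _ => c u v; rewrite mulmxDl scalemxAl.
Qed.

Lemma lin_loop_opr k j M : lin (loop_op k j M).
Proof.
apply: lin_comp (lin_single _) _ => c x y.
by rewrite lin_twisted_op linearD linearZ /= mulmxDr scalemxAr.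
Qed.

Lemma lin_der_mxl r k u : lin (fun M => der_mx r k M u).
Proof.
by apply: lin_add => [|c u' v]; [apply: lin_scale | rewrite linearP].
Qed.

Lemma lin_dotl v : lin (fun u : 'rV[F]_n => dot u v : F^o).
Proof. by move=> c u u'; rewrite !(dotC _ v) dotDr dotZr. Qed.

Lemma lin_der_mxr r k M : lin (der_mx r k M).
Proof.
apply: lin_add => c u u'; first by rewrite lin_dotl scalerDl scalerA.
by rewrite linearP /=; have [-> _] := heta; rewrite mulmxDl scalemxAl.
Qed.

Lemma lin_der_opl k r u : lin (der_op k r ^~ u).
Proof. exact: lin_comp (lin_single _) (lin_der_mxl _ _ _). Qed.

Lemma lin_der_opr k r M : lin (der_op k r M).
Proof. exact: lin_comp (lin_single _) (lin_der_mxr _ _ _). Qed.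

Lemma lin_actr X : lin (act X).
Proof.
case: X => [[f z] d] c u v; rewrite !act_split /loop_act /der_act.
rewrite (lin_convl lin_loop_opl) (lin_convl lin_der_opl).
by rewrite scalerDr addrACA.
Qed.

Lemma lin_actl w : lin (act ^~ w).
Proof.
move=> c [[f z] d] [[f' z'] d']; rewrite !act_split /loop_act /der_act.
rewrite (lin_convr lin_loop_opr) (lin_convr lin_der_opr).
by rewrite scalerDr addrACA.
Qed.

Lemma act_loop j x w : act (elt_loop j x) w = conv loop_op w (single j x).
Proof.
by rewrite act_split /der_act (lin0 (lin_convr lin_der_opr _)) addr0.
Qed.

Lemma act_d r u w : act (elt_d g r u) w = conv der_op w (single r u).
Proof.
by rewrite act_split /loop_act (lin0 (lin_convr lin_loop_opr _)) add0r.
Qed.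

Lemma act_loop_single j x k M :
  act (elt_loop j x) (single k M) = single (k + j) (M *m (op j x)^T).
Proof. by rewrite act_loop (conv_single lin_loop_opl lin_loop_opr). Qed.

Lemma act_d_single r u k M :
  act (elt_d g r u) (single k M) = single (k + r) (der_mx r k M u).
Proof. by rewrite act_d (conv_single lin_der_opl lin_der_opr). Qed.

Lemma lin_elt_loop j : lin (@elt_loop F n g j).
Proof.
by move=> c x y; rewrite /elt_loop lin_single; congr (_, _, _);
  rewrite /= scaler0 addr0.
Qed.

Lemma lin_elt_d r : lin (@elt_d F n g r).
Proof.
by move=> c x y; rewrite /elt_d lin_single; congr (_, _, _);
  rewrite /= scaler0 addr0.
Qed.

Lemma loop_loopE f f' :
  loop_loop br f f' =
  conv (fun (k j : Zn n) x y => single (k + j) (br x y)) f f'.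
Proof. by []. Qed.

Lemma d_loopE d f : d_loop d f =
  conv (fun (r k : Zn n) u (x : g) =>
    single (k + r) (dot u (intv F k) *: x)) d f.
Proof. by []. Qed.

Lemma d_dE d d' : d_d d d' = conv (fun (r j : Zn n) (u v : 'rV[F]_n) =>
  single (r + j) (dot u (intv F j) *: v - dot v (intv F r) *: u)) d d'.
Proof. by []. Qed.

Lemma loop_act_loop f f' w :
  loop_act (loop_loop br f f') w =
  loop_act f (loop_act f' w) - loop_act f' (loop_act f w).
Proof.
have [brl brr _ _] := hbr.
have bl k j v' : lin (fun v => @single (Zn n) g (k + j) (br v v')).
  by apply: lin_comp (lin_single _) _ => c u v; rewrite brl.
have bR k j v : lin (fun v' => @single (Zn n) g (k + j) (br v v')).
  by apply: lin_comp (lin_single _) _ => c u v'; rewrite brr.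
have Ll w' : lin (loop_act ^~ w') := lin_convr lin_loop_opr w'.
have Lr f'' : lin (loop_act f'') := lin_convl lin_loop_opl f''.
apply: (@trilin_ext F _ _ _ _ _ _ _ f f' w
  (fun f f' w => loop_act (loop_loop br f f') w)
  (fun f f' w => loop_act f (loop_act f' w) - loop_act f' (loop_act f w))).
- by move=> *; apply: lin_comp (Ll _) (lin_convl bl _).
- by move=> *; apply: lin_comp (Ll _) (lin_convr bR _).
- by move=> *; apply: Lr.
- by move=> *; apply: lin_sub; [apply: Ll | apply: lin_comp (Lr _) (Ll _)].
- by move=> *; apply: lin_sub; [apply: lin_comp (Lr _) (Ll _) | apply: Ll].
- by move=> *; apply: lin_sub; apply: lin_comp (Lr _) (Lr _).
move=> i u j v k M _ _.
rewrite loop_loopE (conv_single bl bR) /loop_act.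
rewrite !(conv_single lin_loop_opl lin_loop_opr) /loop_op.
rewrite -!addrA [j + i]addrC -singleB; congr single.
(* Transposition reverses products, which matches the order of successive right multiplications. *)
by rewrite twisted_op_bracket linearB /= !trmx_mul mulmxBr !mulmxA.
Qed.

Lemma der_act_loop (d : finfam (Zn n) 'rV[F]_n) f w :
  (forall r, ~ Gamma m r -> d r = 0) ->
  loop_act (d_loop d f) w =
  der_act d (loop_act f w) - loop_act f (der_act d w).
Proof.
move=> dG.
have bl r k x : lin (fun u => @single (Zn n) g (k + r) (dot u (intv F k) *: x)).
  apply: lin_comp (lin_single _) _ => c u v.
  by rewrite lin_dotl scalerDl scalerA.
have bR r k u : lin (fun x => @single (Zn n) g (k + r) (dot u (intv F k) *: x)).
  by apply: lin_comp (lin_single _) (lin_scale _).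
have Ll w' : lin (loop_act ^~ w') := lin_convr lin_loop_opr w'.
have Lr f'' : lin (loop_act f'') := lin_convl lin_loop_opl f''.
have Dl w' : lin (der_act ^~ w') := lin_convr lin_der_opr w'.
have Dr f'' : lin (der_act f'') := lin_convl lin_der_opl f''.
apply: (@trilin_ext F _ _ _ _ _ _ _ d f w
  (fun d f w => loop_act (d_loop d f) w)
  (fun d f w => der_act d (loop_act f w) - loop_act f (der_act d w))).
- by move=> *; apply: lin_comp (Ll _) (lin_convl bl _).
- by move=> *; apply: lin_comp (Ll _) (lin_convr bR _).
- by move=> *; apply: Lr.
- by move=> *; apply: lin_sub; [apply: Dl | apply: lin_comp (Lr _) (Dl _)].
- by move=> *; apply: lin_sub; [apply: lin_comp (Dr _) (Ll _) | apply: Ll].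
- by move=> *; apply: lin_sub;
  [apply: lin_comp (Dr _) (Lr _) | apply: lin_comp (Lr _) (Dr _)].
move=> r u j x k M rd _.
(* Since [r] is in [Gamma], the operators of degrees [j + r] and [j] agree. The [eta] terms then
   cancel, leaving the scalar [dot u (intv F j)]. *)
have rG : Gclass m (j + r) = Gclass m j.
  rewrite (GclassD (multiloop_gt0 hsigma)) (_ : Gclass m r = 0) ?addr0 //.
  apply: Gclass_Gamma; apply: contrapT => nG.
  by have dr0 := dG r nG; rewrite mem_finsupp dr0 eqxx in rd.
rewrite d_loopE (conv_single bl bR) /loop_act /der_act.
rewrite !(conv_single lin_loop_opl lin_loop_opr) /loop_op.
rewrite !(conv_single lin_der_opl lin_der_opr) /der_op.
rewrite !(conv_single lin_loop_opl lin_loop_opr) /loop_op.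
rewrite -!addrA [r + j]addrC -singleB; congr single.
rewrite (eq_twisted_op rG) (linZ _ _ (lin_twisted_op _)) /der_mx mulmxDl mulmxA.
rewrite opprD addrACA subrr addr0 linearZ /= -scalemxAr -scalemxAl -scalerBl.
by congr (_ *: _); rewrite intvD !dotDr; ring.
Qed.

Lemma der_act_der d d' w :
  der_act (d_d d d') w = der_act d (der_act d' w) - der_act d' (der_act d w).
Proof.
have bl r k v : lin (fun u => @single (Zn n) 'rV[F]_n (r + k)
    (dot u (intv F k) *: v - dot v (intv F r) *: u)).
  apply: lin_comp (lin_single _) _; apply: lin_sub; last exact: lin_scale.
  by move=> c u u'; rewrite lin_dotl scalerDl scalerA.
have bR r k u : lin (fun v => @single (Zn n) 'rV[F]_n (r + k)
    (dot u (intv F k) *: v - dot v (intv F r) *: u)).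
  apply: lin_comp (lin_single _) _; apply: lin_sub; first exact: lin_scale.
  by move=> c v v'; rewrite lin_dotl scalerDl scalerA.
have Dl w' : lin (der_act ^~ w') := lin_convr lin_der_opr w'.
have Dr f'' : lin (der_act f'') := lin_convl lin_der_opl f''.
apply: (@trilin_ext F _ _ _ _ _ _ _ d d' w
  (fun d d' w => der_act (d_d d d') w)
  (fun d d' w => der_act d (der_act d' w) - der_act d' (der_act d w))).
- by move=> *; apply: lin_comp (Dl _) (lin_convl bl _).
- by move=> *; apply: lin_comp (Dl _) (lin_convr bR _).
- by move=> *; apply: Dr.
- by move=> *; apply: lin_sub; [apply: Dl | apply: lin_comp (Dr _) (Dl _)].
- by move=> *; apply: lin_sub; [apply: lin_comp (Dr _) (Dl _) | apply: Dl].
- by move=> *; apply: lin_sub; apply: lin_comp (Dr _) (Dr _).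
move=> r u t v k M _ _.
rewrite d_dE (conv_single bl bR) /der_act.
rewrite !(conv_single lin_der_opl lin_der_opr) /der_op.
rewrite -!addrA [t + r]addrC -singleB; congr single.
rewrite /der_mx.
have dotT (x y : 'rV[F]_n) : x *m y^T = (dot x y)%:M.
  rewrite [LHS]mx11_scalar mxE; congr (_%:M).
  by apply: eq_bigr => i _; rewrite mxE.
(* The bracket of these rank one matrices accounts for the mixed terms of the expanded product
   below; the terms in [S] and [R] alone come from the scalar parts, whose value changes with the
   degree shift. *)
set R := (intv F r)^T *m u; set S := (intv F t)^T *m v.
have brRS : gl_bracket R S =
    dot u (intv F t) *: ((intv F r)^T *m v) -
      dot v (intv F r) *: ((intv F t)^T *m u).
  rewrite /gl_bracket /R /S !mulmxA -[_ *m u *m _]mulmxA -[_ *m v *m _]mulmxA.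
  by rewrite !dotT !mul_mx_scalar -!scalemxAl.
have -> : (intv F (r + t))^T *m
      (dot u (intv F t) *: v - dot v (intv F r) *: u) =
    gl_bracket R S + (dot u (intv F t) *: S - dot v (intv F r) *: R).
  rewrite brRS intvD [(_ + _)^T]linearD /= mulmxDl.
  rewrite !mulmxBr -!scalemxAr.
  by rewrite addrACA [- _ - _]addrC addrACA.
have [etaD ->] : (forall X Y, eta (X + Y) = eta X + eta Y) /\
    eta (gl_bracket R S + (dot u (intv F t) *: S - dot v (intv F r) *: R)) =
    (eta R *m eta S - eta S *m eta R) +
      (dot u (intv F t) *: eta S - dot v (intv F r) *: eta R).
  have etaD X Y : eta (X + Y) = eta X + eta Y.
    by have [/(_ 1 X Y)] := heta; rewrite !scale1r.
  split=> //; rewrite etaD; have [_ ->] := heta; congr (_ + _).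
  by rewrite etaD -scaleNr !(lie_repZ heta) scaleNr.
have -> x b e : dot (b *: v - e *: u) x = b * dot v x - e * dot u x.
  by rewrite dotC dotDr -scaleN1r !dotZr mulN1r (dotC _ v) (dotC _ u).
rewrite !intvD !dotDr.
rewrite mulmxDl !mulmxBl !mulmxDr -!scalemxAl -!scalemxAr -!mulmxA.
move: (eta R *m (eta S *m M)) (eta S *m (eta R *m M)) (eta R *m M) (eta S *m M)
  => RS SR RM SM.
apply/matrixP => i j; rewrite !mxE; ring.
Qed.

(** The form and the cocycles contribute only to the central component, which acts by 0, so the
    relation splits into the loop, mixed and derivation cases. *)
Lemma act_bracket c1 c2 X Y w :
  twisted_toroidal m sigma xi X -> twisted_toroidal m sigma xi Y ->
  act (toroidal_bracket br frm c1 c2 X Y) w =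
  act X (act Y w) - act Y (act X w).
Proof.
case: X Y => [[f z] d] [[f' z'] d'] [_ _ _ dG] [_ _ _ d'G].
rewrite /toroidal_bracket !act_split.
have Ll w' : lin (loop_act ^~ w') := lin_convr lin_loop_opr w'.
have Lr f'' : lin (loop_act f'') := lin_convl lin_loop_opl f''.
have Dr f'' : lin (der_act f'') := lin_convl lin_der_opl f''.
rewrite -scaleN1r !(linD _ _ (Ll _)) (linZ _ _ (Ll _)) !(linD _ _ (Lr _))
  !(linD _ _ (Dr _)).
rewrite loop_act_loop der_act_der !der_act_loop // scaleN1r opprB.
move: (loop_act f (loop_act f' w)) (loop_act f' (loop_act f w)) => A1 A2.
move: (der_act d (loop_act f' w)) (loop_act f' (der_act d w)) => A3 A4.
move: (loop_act f (der_act d' w)) (der_act d' (loop_act f w)) => A5 A6.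
move: (der_act d (der_act d' w)) (der_act d' (der_act d w)) => A7 A8.
apply/fsfunP => k; rewrite !(ff_addE, ff_oppE).
by apply/matrixP => i j; rewrite !mxE; ring.
Qed.

(** * The graded submodule V' and the graded irreducibility of V_2 *)

Section Graded.
Variable gr : quotG m -> {vspace 'cV[F]_Q}.
Hypothesis hgi : graded_irreducible sigma xi rep gr.
Let hgr : is_grading sigma xi rep gr. Proof. by case: hgi. Qed.

Definition homogeneous (b : quotG m) (M : 'M[F]_(p, Q)) : Prop :=
  forall i, (row i M)^T \in gr b.

Lemma homogeneous_subspace b : subspace (homogeneous b).
Proof.
split=> [i|c M M' hM hM' i]; first by rewrite row0 trmx0 mem0v.
by rewrite !linearP /= memvD ?memvZ.
Qed.

Lemma homogeneousM b M (A : 'M[F]_p) :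
  homogeneous b M -> homogeneous b (A *m M).
Proof.
move=> hM i; rewrite row_mul mulmx_sum_row linear_sum /=.
by apply: memv_suml => j _; rewrite linearZ /= memvZ.
Qed.

Lemma homogeneous_op b b' M (B : 'M[F]_Q) :
  (forall v, v \in gr b -> B *m v \in gr b') ->
  homogeneous b M -> homogeneous b' (M *m B^T).
Proof. by move=> hB hM i; rewrite row_mul trmx_mul trmxK hB. Qed.

Lemma homogeneous_pure b (v1 : 'cV[F]_p) (v2 : 'cV_Q) :
  v2 \in gr b -> homogeneous b (v1 *m v2^T).
Proof.
move=> hv i; rewrite row_mul trmx_mul trmxK.
by rewrite [row i v1]mx11_scalar tr_scalar_mx mul_mx_scalar memvZ.
Qed.

Local Notation V' := (Vprime (p := p) gr).

Lemma Vprime_subspace : subspace V'.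
Proof.
split=> [k i|c u v hu hv k i].
  by rewrite ff_zeroE row0 trmx0 mem0v.
rewrite ff_addE ff_scaleE; have [_] := homogeneous_subspace (Gclass m k).
by apply; [apply: hu | apply: hv].
Qed.

Lemma Vprime_single k M : homogeneous (Gclass m k) M -> V' (single k M).
Proof.
move=> hM j i; rewrite singleE; case: eqP => [->|_]; first exact: hM.
by rewrite row0 trmx0 mem0v.
Qed.

Lemma op_graded j x b v : x \in gk sigma xi j -> v \in gr b ->
  op j x *m v \in gr (Gclass m j + b).
Proof.
move=> xj vb; rewrite -(twisted_rep_homogeneous xj).
by have [_ _] := hgr; apply.
Qed.

(** The operators of [gk j] shift the grading of V_2 by the class of [j], as t^j does; derivations
    have degree in [Gamma], of class 0, and act on V_1 only. *)
Lemma Vprime_stable : stable_under (twisted_toroidal m sigma xi) act V'.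
Proof.
case=> [[f z] d] w [hf _ _ hd] hw; rewrite act_split /loop_act /der_act.
have GD := GclassD (multiloop_gt0 hsigma).
apply: (subspaceD Vprime_subspace).
  apply: (subspace_sum_seq Vprime_subspace) => k _.
  apply: (subspace_sum_seq Vprime_subspace) => j _.
  apply: Vprime_single; rewrite GD addrC.
  by apply: homogeneous_op (hw _) => v; apply: op_graded.
apply: (subspace_sum_seq Vprime_subspace) => k _.
apply: (subspace_sum_seq Vprime_subspace) => r dr.
apply: Vprime_single; rewrite GD (_ : Gclass m r = 0).
  rewrite addr0; apply: (subspaceD (homogeneous_subspace _)).
    exact: (subspaceZ (homogeneous_subspace _)) (hw _).
  exact: homogeneousM (hw _).
apply: Gclass_Gamma; apply: contrapT => nG.
by have dr0 := hd r nG; rewrite mem_finsupp dr0 eqxx in dr.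
Qed.

Lemma Vprime_module c1 c2 :
  lie_module (twisted_toroidal m sigma xi) (toroidal_bracket br frm c1 c2) V'
    act.
Proof.
split; [exact: Vprime_subspace | exact: Vprime_stable | | | ].
- by move=> c X Y w _ _ _; rewrite lin_actl.
- by move=> c X v w _ _ _; rewrite lin_actr.
- by move=> X Y w hX hY _; apply: act_bracket.
Qed.

(** Graded irreducibility for predicates given degree by degree: the sum of the [W b] is a graded
    submodule, so it is zero or full. *)
Lemma graded_irreducible_family (W : quotG m -> 'cV[F]_Q -> Prop) :
  (forall b, subspace (W b)) -> (forall b v, W b v -> v \in gr b) ->
  (forall j x b v, x \in gk sigma xi j -> W b v ->
     W (Gclass m j + b) (op j x *m v)) ->
  (forall b v, W b v -> v = 0) \/ (forall b v, v \in gr b -> W b v).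
Proof.
move=> sW Wgr stW.
have [E EP] := boolp.choice (fun b => subspace_vspace (sW b)).
pose U := (\sum_b E b)%VS.
have invU : Defs.invariant rep U.
  move=> x v /memv_sumP[u uE ->]; rewrite mulmx_sumr.
  apply: memv_suml => b _; rewrite twisted_rep_gcomp mulmx_suml.
  apply: memv_suml => b' _;
    rewrite (twisted_rep_homogeneous (gcomp_gk _ _ _ _)).
  apply: (subvP (sumv_sup (b' + b) isT (subvv _))).
  rewrite -EP -{1}(GrepK (multiloop_gt0 hsigma) b').
  by apply: stW; [apply: gcomp_gk | apply/EP/uE].
have grU : (\sum_b (U :&: gr b))%VS = U.
  apply/eqP; rewrite eqEsubv; apply/andP; split.
    by apply/subv_sumP => b _; apply: capvSl.
  apply/subv_sumP => b _; apply: (sumv_sup b) => //.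
  rewrite subv_cap (sumv_sup b) //=.
  by apply/subvP => v /EP; apply: Wgr.
have [_ _ /(_ U invU grU)[U0|Ufull]] := hgi.
  left=> b v /EP vE; apply/eqP; rewrite -memv0 -U0.
  exact: (subvP (sumv_sup b isT (subvv _))).
right=> b v vb.
have : v \in U by rewrite Ufull memvf.
case/memv_sumP=> u uE vu.
have [dir _ _] := hgr.
(* Two decompositions of [v] are compared: the one concentrated in degree [b], and the one with
   components in the [W b']. *)
have := directv_sum_unique dir (fun b' => v *+ (b' == b)) u.
have -> : \sum_b' v *+ (b' == b) = \sum_b' u b'.
  by rewrite -vu (bigD1 b) //= eqxx [X in _ + X]big1 ?addr0 // => b' /negPf->.
rewrite eqxx => /(_ _ _)/esym/forall_inP/(_ b isT).
rewrite eqxx => /(_ _ _)/eqP uv.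
rewrite [v]uv; first exact/EP/uE.
  by move=> b' _; case: eqP => [->|_]; rewrite ?mem0v.
by move=> b' _; apply/Wgr/EP/uE.
Qed.

(* [Good] plays the role of the non-unital graded algebra generated by the image
   of g. By irreducibility every homogeneous v has B in [Good 0] with B v = v;
   if B fixes v_1, .., v_s and B' fixes v - B v, then 1 - (1 - B') (1 - B) fixes
   v_1, .., v_s and v. *)
Lemma unit_in_augmentation (Good : quotG m -> 'M[F]_Q -> Prop) :
  (forall b, subspace (Good b)) ->
  (forall b b' B v, Good b B -> v \in gr b' -> B *m v \in gr (b + b')) ->
  (forall b b' B B', Good b B -> Good b' B' -> Good (b + b') (B *m B')) ->
  (forall j x, x \in gk sigma xi j -> Good (Gclass m j) (op j x)) ->
  (exists x, rep x != 0) -> Good 0 1%:M.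
Proof.
move=> sG Ggr GM Gop [x0 repx0].
(* The vectors killed by g form a graded submodule; it is not everything because g acts
   non-trivially, hence it is zero. *)
have op_inj b v : v \in gr b ->
    (forall j x, x \in gk sigma xi j -> op j x *m v = 0) -> v = 0.
  move=> vb opv.
  pose W b v :=
    v \in gr b /\ forall j x, x \in gk sigma xi j -> op j x *m v = 0.
  have [||| W0|Wall] := @graded_irreducible_family W.
  - move=> b'; split=> [|c u w [ub uK] [wb wK]].
      by split=> [|*]; rewrite ?mem0v ?mulmx0.
    split=> [|j x xj]; first by rewrite memvD ?memvZ.
    by rewrite mulmxDr -scalemxAr uK // wK // scaler0 addr0.
  - by move=> ? ? [].
  - move=> j x b' u xj [ub uK]; rewrite uK //.
    by split=> [|*]; rewrite ?mem0v ?mulmx0.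
  - exact: (W0 b).
  case/eqP: repx0; apply: mulmx_cV_inj => u; rewrite mul0mx.
  have [_ /vspaceP/(_ u) + _] := hgr; rewrite memvf => /memv_sumP[us usE ->].
  rewrite mulmx_sumr [LHS]big1 // => b' _.
  rewrite twisted_rep_gcomp mulmx_suml [LHS]big1 // => d _.
  rewrite (@twisted_rep_homogeneous (Grep d)) ?gcomp_gk //.
  by have [_ ->] := Wall b' _ (usE b' isT); rewrite ?gcomp_gk.
(* The [B *m v] with [B] in some [Good] form a graded submodule. If it is zero, then g kills [v] and
   [v = 0]; otherwise it contains [v]. *)
have local_unit b v : v \in gr b -> exists2 B, Good 0 B & B *m v = v.
  move=> vb; pose W b' u := exists2 B, Good (b' - b) B & u = B *m v.
  have [||| W0|Wall] := @graded_irreducible_family W.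
  - move=> b'; split=> [|c _ _ [B GB ->] [B' GB' ->]].
      by exists 0; rewrite ?mul0mx //; apply: subspace0 (sG _).
    exists (c *: B + B'); first by have [_] := sG (b' - b); apply.
    by rewrite mulmxDl scalemxAl.
  - by move=> b' _ [B GB ->]; rewrite -[b'](subrK b); apply: Ggr.
  - move=> j x b' _ xj [B GB ->]; exists (op j x *m B); last by rewrite mulmxA.
    by rewrite -addrA; apply: GM => //; apply: Gop.
  - have -> : v = 0.
      apply: op_inj vb _ => j x xj; apply: (W0 (Gclass m j + b)).
      by exists (op j x); rewrite ?addrK //; apply: Gop.
    by exists 0; rewrite ?mulmx0 //; apply: subspace0 (sG _).
  by have [B GB Bv] := Wall b v vb; exists B; rewrite -?Bv // -(subrr b).
have common_unit (r : seq 'cV[F]_Q) :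
    (forall v, v \in r -> exists b, v \in gr b) ->
    exists2 B, Good 0 B & forall v, v \in r -> B *m v = v.
  elim: r => [|v r IHr] hr; first by exists 0 => //; apply: subspace0 (sG _).
  have [|B GB Br] := IHr.
    by move=> u ur; apply: hr; rewrite in_cons ur orbT.
  have [b vb] := hr v (mem_head _ _).
  have Bvb : v - B *m v \in gr b.
    by rewrite memvB // -[b]add0r; apply: Ggr.
  have [B' GB' B'v] := local_unit b _ Bvb.
  exists (B + B' - B' *m B).
    apply: (subspaceB (sG 0)); first exact: (subspaceD (sG 0)).
    by rewrite -(addr0 0); apply: GM.
  move=> u; rewrite in_cons mulmxBl mulmxDl -mulmxA.
  case/orP=> [/eqP->|ur]; last by rewrite Br // addrK.
  by rewrite -addrA -mulmxBr B'v addrC subrK.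
(* A matrix fixing bases of all the [gr b] is the identity. *)
have [|B GB Br] := common_unit
  (flatten [seq (vbasis (gr b) : seq _) | b <- enum (quotG m)]).
  by move=> v /flattenP[r /mapP[b _ ->] vr]; exists b; apply: vbasis_mem.
suff <- : B = 1%:M by [].
apply: mulmx_cV_inj => u; rewrite mul1mx.
have [_ /vspaceP/(_ u) + _] := hgr; rewrite memvf => /memv_sumP[us usE ->].
rewrite mulmx_sumr; apply: eq_bigr => b _.
rewrite (coord_vbasis (usE b isT)) mulmx_sumr; apply: eq_bigr => i _.
rewrite -scalemxAr Br //; apply/flattenP; exists (vbasis (gr b) : seq _).
  by apply: map_f; rewrite mem_enum.
by apply: mem_nth; rewrite size_tuple.
Qed.

Hypothesis eta_irr : irreducible_rep eta.
Hypothesis rep_neq0 : exists x, rep x != 0.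

Lemma op_neq0 : exists (b : quotG m) x,
  x \in gk sigma xi (Grep b) /\ op (Grep b) x != 0.
Proof.
have [x repx] := rep_neq0; apply: contrapT => noop; case/eqP: repx.
rewrite twisted_rep_gcomp [LHS]big1 // => b _.
rewrite (@twisted_rep_homogeneous (Grep b)) ?gcomp_gk //.
apply/eqP; apply: contrapT => /negP opb; apply: noop.
by exists b, (gcomp sigma xi b x); rewrite gcomp_gk.
Qed.

(** The vectors [X *m v] with [X] in [A] form a submodule of V_1 containing [v], hence all of V_1.
    This is the transitivity asked for by [burnside_rank1]. *)
Lemma eta_transitive (A : 'M[F]_p -> Prop) (v w : 'cV_p) :
  subspace A -> A 1%:M -> (forall X Y, A X -> A Y -> A (X *m Y)) ->
  (forall X, A (eta X)) -> v != 0 -> exists2 X, A X & X *m v = w.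
Proof.
move=> sA A1 AM Aeta v0.
have sW : subspace (fun u => exists2 X, A X & X *m v = u).
  split=> [|c _ _ [X AX <-] [Y AY <-]].
    by exists 0; [apply: subspace0 sA | rewrite mul0mx].
  by exists (c *: X + Y); [case: sA => _; apply | rewrite mulmxDl scalemxAl].
have [U UP] := subspace_vspace sW.
have [_ irr] := eta_irr.
have invU : Defs.invariant eta U.
  move=> X u /UP[Y AY <-]; apply/UP.
  by exists (eta X *m Y); [apply: AM | rewrite mulmxA].
have [U0|Ufull] := irr U invU; last by apply/UP; rewrite Ufull memvf.
have /UP : exists2 X, A X & X *m v = v by exists 1%:M; rewrite ?mul1mx.
by rewrite U0 memv0 (negPf v0).
Qed.

Lemma elt_loop_twisted j x : x \in gk sigma xi j ->
  twisted_toroidal m sigma xi (elt_loop j x).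
Proof.
move=> xj; split=> [k|r|r _|r _]; rewrite ?ff_zeroE //.
  by rewrite singleE; case: eqP => [->|]; rewrite ?mem0v.
by rewrite sub0mx.
Qed.

Lemma elt_d_twisted r u :
  Gamma m r -> twisted_toroidal m sigma xi (elt_d g r u).
Proof.
move=> rG; split=> [k|k|k _|k kG]; rewrite ?ff_zeroE //.
- by rewrite mem0v.
- by rewrite sub0mx.
- by rewrite singleE; case: eqP => // kr; case: kG; rewrite kr.
Qed.

Lemma Vprime_nontrivial : nontrivial_loop_action sigma xi V' act.
Proof.
have [b [x [xb opx]]] := op_neq0.
have [b' [v [vb' opv]]] : exists b' v, v \in gr b' /\ op (Grep b) x *m v != 0.
  apply: contrapT => nov; case/eqP: opx.
  apply: mulmx_cV_inj => u; rewrite mul0mx.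
  have [_ /vspaceP/(_ u) + _] := hgr; rewrite memvf => /memv_sumP[us usE ->].
  rewrite mulmx_sumr [LHS]big1 // => b' _; apply/eqP/negP => /negP opu.
  by apply: nov; exists b', (us b'); rewrite usE.
have [p_gt0 _] := eta_irr.
pose e := delta_mx (Ordinal p_gt0) 0 : 'cV[F]_p.
exists (Grep b), x, (single (Grep b') (e *m v^T)); split=> //.
  apply/Vprime_single/homogeneous_pure.
  by rewrite GrepK //; apply: multiloop_gt0 hsigma.
rewrite act_loop_single.
apply: contra opv => /eqP/fsfunP/(_ (Grep b' + Grep b)).
rewrite singleE eqxx ff_zeroE -mulmxA -trmx_mul => eopv.
rewrite -trmx_eq0 -[X in X == _]mul1mx.
(* Left multiplication by [e^T] strips the factor [e] from the vanishing tensor. *)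
have -> : 1%:M = e^T *m e.
  apply/matrixP => i j; rewrite !ord1 [RHS]mxE (bigD1 (Ordinal p_gt0)) //=.
  rewrite big1 => [|k /negPf k0]; rewrite !mxE ?eqxx ?k0 ?mulr0 //.
  by rewrite mulr1 addr0.
by rewrite -mulmxA eopv mulmx0.
Qed.

Lemma sum_pure (M : 'M[F]_(p, Q)) :
  M = \sum_i delta_mx i 0 *m row i M :> 'M_(p, Q).
Proof.
apply/row_matrixP => i; rewrite linear_sum (bigD1 i) //=.
rewrite [X in _ + X]big1 => [|j ji].
  rewrite addr0 row_mul -[LHS]mul1mx; congr (_ *m _).
  by apply/matrixP => i' j'; rewrite !ord1 !mxE !eqxx.
rewrite row_mul (_ : row i _ = 0) ?mul0mx //.
by apply/rowP => k; rewrite !mxE eq_sym (negPf ji).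
Qed.

(** * Irreducibility *)

Section Submodule.
Variable U : finfam (Zn n) 'M[F]_(p, Q) -> Prop.
Hypotheses (sU : subspace U) (UV : forall u, U u -> V' u).
Hypothesis stU : stable_under (twisted_toroidal m sigma xi) act U.

Lemma submodule_loop j x k M : x \in gk sigma xi j -> U (single k M) ->
  U (single (k + j) (M *m (op j x)^T)).
Proof.
move=> xj uM; rewrite -act_loop_single.
by apply: stU => //; apply: elt_loop_twisted.
Qed.

Lemma submodule_d r u k M : Gamma m r -> U (single k M) ->
  U (single (k + r) (der_mx r k M u)).
Proof.
move=> rG uM; rewrite -act_d_single.
by apply: stU => //; apply: elt_d_twisted.
Qed.

(** The [d_i] act on the coefficient of t^k by [k_i + beta_i], and the integers embed in [F], so
    distinct [k] have distinct characters. *)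
Lemma submodule_coef u k : U u -> U (single k (u k)).
Proof.
move=> Uu; case: (finsuppP u k) => [_|uk].
  by rewrite single0; apply: subspace0 sU.
have G0 : Gamma m (0 : Zn n) by move=> i; rewrite mxE dvdz0.
have stD i w : U w -> U (act (elt_d g 0 (delta_mx 0 i)) w).
  by apply: stU; apply: elt_d_twisted.
refine (@eigen_separation F tA 'I_n (Zn n)
  (fun i => act (elt_d g 0 (delta_mx 0 i)))
  (fun k i => dot (delta_mx 0 i) (intv F k + beta)) U (finsupp u)
  (fun k => single k (u k)) _ sU stD (fset_uniq _) _ _ _ k uk).
- by move=> i; apply: lin_actr.
- move=> j i _; rewrite act_d_single addr0 /der_mx.
  have -> : intv F (0 : Zn n) = 0 by apply/rowP => i'; rewrite !mxE.
  by rewrite trmx0 mul0mx (lie_rep0 heta) mul0mx addr0 singleZ.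
- move=> j j' _ _ neqj; apply: contrapT => same; case/eqP: neqj.
  apply/rowP => i; have dotd (v : 'rV[F]_n) : dot (delta_mx 0 i) v = v 0 i.
    rewrite /dot (bigD1 i) //= mxE !eqxx mul1r big1 ?addr0 // => i' ni.
    by rewrite mxE (negPf ni) mul0r.
  have : dot (delta_mx 0 i) (intv F j + beta) =
      dot (delta_mx 0 i) (intv F j' + beta).
    by apply/eqP; apply: contrapT => /negP neq; apply: same; exists i.
  by rewrite !dotd !mxE => /addIr/intr_inj.
- by rewrite -finfam_sum.
Qed.

Lemma submodule_shift k r M :
  Gclass m r = 0 -> U (single k M) -> U (single (k + r) M).
Proof.
(* Every exponent [j] of class [b] is allowed, not just one: for the identity in class 0 this is the
   shift by all of [Gamma]. The image of g qualifies because [gk] and [op] depend on the class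
   only. *)
pose Good b B := (forall b' v, v \in gr b' -> B *m v \in gr (b + b')) /\
  forall k j M, Gclass m j = b ->
    U (single k M) -> U (single (k + j) (M *m B^T)).
have [_ +] : Good 0 1%:M.
  apply: unit_in_augmentation rep_neq0 =>
      // [b|b b' B v [+ _]|b b' B B'|j x xj].
  - split.
      split=> *; first by rewrite mul0mx mem0v.
      by rewrite trmx0 mulmx0 single0; apply: subspace0 sU.
    move=> c B B' [grB uB] [grB' uB']; split=> [b' v vb'|k' j M' jb UM].
      by rewrite mulmxDl -scalemxAl memvD ?memvZ ?grB ?grB'.
    rewrite linearD linearZ /= mulmxDr -scalemxAr singleD singleZ.
    by case: sU => _; apply; [apply: uB | apply: uB'].
  - exact.
  - move=> [grB uB] [grB' uB']; split=> [d v vd|k' j M' jb UM].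
      by rewrite -mulmxA -addrA; apply/grB/grB'.
    (* The exponent [j] is split as [(j - Grep b) + Grep b]: the first part, of class [b'], goes
       with [B'], the second with [B]. *)
    rewrite trmx_mul mulmxA -[j](subrK (Grep b)) addrA.
    apply: uB; first by rewrite GrepK //; apply: multiloop_gt0 hsigma.
    apply: uB' => //; rewrite GclassB ?GrepK ?jb //;
      try exact: multiloop_gt0 hsigma.
    by rewrite addrC addKr.
  split=> [b' v vb'|k' j' M' jb UM]; first exact: op_graded.
  by rewrite (eq_twisted_op (esym jb)); apply: submodule_loop;
    rewrite // (eq_gk hsigma jb).
by move=> /(_ k r M) + r0 UM => /(_ r0 UM); rewrite trmx1 mulmx1.
Qed.

(** It suffices to treat the matrix units [delta_mx i j]. Acting by t^r d_j with r = m_i e_i,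
    shifting back by -r and subtracting a multiple of M t^k leaves [m i] times the wanted
    element. *)
Lemma submodule_eta k X M : U (single k M) -> U (single k (eta X *m M)).
Proof.
move=> UM; have Udelta i j : U (single k (eta (delta_mx i j) *m M)).
  have m0 : (m i)%:R != 0 :> F.
    by rewrite Num.Theory.pnatr_eq0 -lt0n (multiloop_gt0 hsigma).
  pose r : Zn n := (m i)%:Z *: delta_mx 0 i.
  have rG : Gamma m r.
    move=> i'; rewrite !mxE eqxx /=.
    by case: eqP => [->|_]; rewrite ?mulr1 ?mulr0 ?dvdz0.
  have r0 := Gclass_Gamma rG.
  have : U (single (k + r - r) (der_mx r k M (delta_mx 0 j))).
    apply: submodule_shift; last exact: submodule_d.
    by rewrite -[- r]add0r (GclassB (multiloop_gt0 hsigma)) r0 Gclass0 ?subr0.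
  rewrite addrK /der_mx singleD => UD.
  have := subspaceB sU UD
    (subspaceZ sU (dot (delta_mx 0 j) (intv F k + beta)) UM).
  rewrite -singleZ addrC addKr.
  have -> : (intv F r)^T *m delta_mx 0 j = (m i)%:R *: delta_mx i j.
    apply/matrixP => i' j'; rewrite !mxE big_ord1 !mxE !eqxx /=.
    by case: (i' == i); rewrite /= ?mulr1 ?mulr0 ?mul0r //.
  rewrite (lie_repZ heta) -scalemxAl singleZ.
  exact: subspaceZK.
rewrite [X]matrix_sum_delta (lie_rep_sum heta) mulmx_suml single_sum.
apply: (subspace_sum sU) => i _.
rewrite (lie_rep_sum heta) mulmx_suml single_sum.
apply: (subspace_sum sU) => j _.
by rewrite (lie_repZ heta) -scalemxAl singleZ; apply: subspaceZ.
Qed.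

Lemma submodule_full u : U u -> u != 0 -> forall w, V' w -> U w.
Proof.
(* [A] consists of the endomorphisms of V_1 preserving [U]; a rank one element of it extracts a pure
   tensor from [u]. *)
move=> Uu u0; pose A X := forall k M, U (single k M) -> U (single k (X *m M)).
have sA : subspace A.
  split=> [k M _|c X Y AX AY k M UM].
    by rewrite mul0mx single0; apply: subspace0 sU.
  rewrite mulmxDl -scalemxAl singleD singleZ.
  by case: sU => _; apply; [apply: AX | apply: AY].
have A1 : A 1%:M by move=> k M; rewrite mul1mx.
have AM X Y : A X -> A Y -> A (X *m Y).
  by move=> AX AY k M UM; rewrite -mulmxA; apply/AX/AY.
have Aeta X : A (eta X) by move=> k M; apply: submodule_eta.
have Atrans v w := @eta_transitive A v w sA A1 AM Aeta.
have [p_gt0 _] := eta_irr.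
have [T AT rT] := burnside_rank1 p_gt0 sA AM A1 Atrans.
have [t [r TE]] : exists (t : 'cV_p) (r : 'rV_p), T = t *m r.
  rewrite -(mulmx_base T); move: (col_base T) (row_base T).
  by rewrite rT => C R; exists C, R.
have [k0 uk0] : exists k, u k != 0.
  apply: contrapT => nok; case/eqP: u0; apply/fsfunP => k; rewrite ff_zeroE.
  by apply/eqP; apply: contrapT => /negP uk; apply: nok; exists k.
have nzv q1 q2 (B : 'M[F]_(q1, q2)) : B != 0 -> exists y : 'cV_q2, B *m y != 0.
  move=> B0; apply: contrapT => noy; case/eqP: B0; apply: mulmx_cV_inj => y.
  by rewrite mul0mx; apply/eqP; apply: contrapT => /negP By; apply: noy;
    exists y.
have [y My] := nzv _ _ _ uk0.
have [z Tz] : exists z : 'cV_p, T *m z != 0.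
  by apply: nzv; rewrite -mxrank_eq0 rT.
have [X AX XMy] := Atrans _ z My.
(* With [T = t r], the matrix [T X (u k0)] is the pure tensor [t *m v2^T]; it is non-zero because it
   maps [y] to [T *m z]. *)
pose v2 := (r *m X *m u k0)^T.
have Uv2 : U (single k0 (t *m v2^T)).
  rewrite trmxK -mulmxA mulmxA -TE.
  by apply: AT; apply: AX; apply: submodule_coef.
have tv2 : t *m v2^T != 0.
  apply: contra Tz => /eqP tv2.
  have -> : T *m z = (t *m v2^T) *m y by rewrite -XMy TE trmxK !mulmxA.
  by rewrite tv2 mul0mx.
have t0 : t != 0 by apply: contra tv2 => /eqP->; rewrite mul0mx.
have v20 : v2 != 0 by apply: contra tv2 => /eqP->; rewrite trmx0 mulmx0.
(* The [f] whose whole V_1 (x) f t^k lies in [U], for all [k] of class [b]; by graded irreducibility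
   they fill V_2 once [v2] is among them. *)
pose W b f := f \in gr b /\
  forall k v1, Gclass m k = b -> U (single k (v1 *m f^T)).
have [||| W0|Wall] := @graded_irreducible_family W.
- move=> b; split.
    by split=> [|*]; rewrite ?mem0v // trmx0 mulmx0 single0;
      apply: subspace0 sU.
  move=> c f f' [fb Uf] [f'b Uf']; split=> [|k v1 kb].
    by rewrite memvD ?memvZ.
  rewrite linearD linearZ /= mulmxDr -scalemxAr singleD singleZ.
  by case: sU => _; apply; [apply: Uf | apply: Uf'].
- by move=> b f [].
- move=> j x b f xj [fb Uf]; split=> [|k v1 kb]; first exact: op_graded.
  rewrite trmx_mul mulmxA -[k](subrK j); apply: submodule_loop => //.
  apply: Uf; rewrite GclassB ?kb; last exact: multiloop_gt0 hsigma.
  by rewrite addrC addKr.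
- case/eqP: v20; apply: (W0 (Gclass m k0)); split=> [|k v1 kk0].
    have [i ti] : exists i, t i 0 != 0.
      apply: contrapT => noi; case/eqP: t0; apply/colP => i; rewrite mxE.
      by apply/eqP; apply: contrapT => /negP ti; apply: noi; exists i.
    (* Row [i] of [t *m v2^T] is a non-zero multiple of [v2^T], and rows of elements of V' are
       homogeneous. *)
    have := UV Uv2 k0 i; rewrite singleE eqxx row_mul [row i t]mx11_scalar mxE.
    rewrite mul_scalar_mx linearZ /= trmxK => /(memvZ (t i 0)^-1).
    by rewrite scalerA mulVf // scale1r.
  (* Transitivity moves [t] to any [v1], and [submodule_shift] moves [k0] to any [k] of its
     class. *)
  have [Y AY <-] := Atrans t v1 t0.
  rewrite -mulmxA -[k](subrK k0) addrC; apply: submodule_shift.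
    by rewrite GclassB ?kk0 ?subrr //; apply: multiloop_gt0 hsigma.
  exact: AY.
move=> w hw; rewrite [w]finfam_sum; apply: (subspace_sum sU) => k _.
rewrite [w k]sum_pure single_sum; apply: (subspace_sum sU) => i _.
rewrite -[row i _]trmxK; have [_] := Wall (Gclass m k) (row i (w k))^T (hw k i).
exact.
Qed.

End Submodule.

Lemma Vprime_irreducible :
  irreducible_module (twisted_toroidal m sigma xi) V' act.
Proof.
split=> [|U sU UV stU].
  have [k [x [w [xk hw actw]]]] := Vprime_nontrivial.
  exists w => //; apply: contra actw => /eqP->.
  by rewrite (lin0 (lin_actr _)).
have [[u Uu u0]|noU] := pselect (exists2 u, U u & u != 0).
  by right; apply: (submodule_full sU UV stU Uu u0).
left=> u Uu; apply/eqP; apply: contrapT => /negP u0; apply: noU.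
by exists u.
Qed.

(** * Weights and integrability *)

Section Weights.
Variable h0 : {vspace g}.
Hypothesis h0_comm : forall u v, u \in h0 -> v \in h0 -> br u v = 0.
Hypothesis h0_gk : (h0 <= gk sigma xi 0)%VS.
Hypothesis h0_diag : forall u, u \in h0 ->
  forall v, sum_of (eigen (mulmx (op 0 u))) (v : 'cV_Q).

(** The elements of [htilde] have degree 0, so they act coefficient by coefficient, and at r = 0 the
    [eta] term vanishes. *)
Lemma act_htilde_coef (H : htilde n h0) w k :
  act (htilde_elt H) w k =
  w k *m (op 0 (vsval H.1.1))^T + dot H.2 (intv F k + beta) *: w k.
Proof.
rewrite /htilde_elt !(linD _ _ (lin_actl w)) tensor_act_K addr0.
pose D1 w := act (elt_loop 0 (vsval H.1.1)) w + act (elt_d g 0 H.2) w.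
pose D2 (w : tA) :=
  w k *m (op 0 (vsval H.1.1))^T + dot H.2 (intv F k + beta) *: w k.
apply: (@lin_ext F (Zn n) 'M[F]_(p, Q) 'M[F]_(p, Q) w (fun w => D1 w k) D2).
- by apply: (lin_comp (lin_coef k)); apply: lin_add; apply: lin_actr.
- apply: lin_add => c u v.
    by rewrite (lin_coef k) mulmxDl scalemxAl.
  by rewrite (lin_coef k) lin_scale.
move=> j _; rewrite /D1 /D2 act_loop_single act_d_single !addr0 -singleD
  !singleE.
case: eqP => [->|_]; last by rewrite mul0mx scaler0 addr0.
rewrite /der_mx; have -> : intv F (0 : Zn n) = 0.
  by apply/rowP => i; rewrite !mxE.
by rewrite trmx0 mul0mx (lie_rep0 heta) mul0mx addr0.
Qed.

Lemma act_htilde_single (H : htilde n h0) k M :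
  act (htilde_elt H) (single k M) =
  single k (M *m (op 0 (vsval H.1.1))^T + dot H.2 (intv F k + beta) *: M).
Proof.
apply/fsfunP => j; rewrite act_htilde_coef !singleE.
by case: eqP => [->//|_]; rewrite mul0mx scaler0 addr0.
Qed.

Lemma lin_htilde_elt : lin (@htilde_elt F n g h0).
Proof.
move=> c [[u z] d] [[u' z'] d'].
have hE u1 z1 d1 : @htilde_elt F n g h0 (u1, z1, d1) =
  elt_loop 0 (vsval u1) + elt_K g 0 z1 + elt_d g 0 d1 by [].
rewrite [LHS](hE (c *: u + u') (c *: z + z') (c *: d + d')) !hE.
have -> : vsval (c *: u + u') = c *: vsval u + vsval u' by rewrite linearP.
rewrite (lin_elt_loop _) lin_elt_d.
have -> : elt_K g 0 (c *: z + z') = c *: elt_K g 0 z + elt_K g 0 z'.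
  by rewrite /elt_K tKD tKZ; congr (_, _, _); rewrite /= scaler0 addr0.
by rewrite !scalerDr [X in X + _ = _]addrACA [LHS]addrACA.
Qed.

Lemma lin_hom (V : vectType F) (f : V -> F^o) : lin f ->
  exists Lam : 'Hom(V, F^o), Lam =1 f.
Proof.
move=> lf; pose L := GRing.isLinear.Build F V F^o _ f lf.
pose fl : {linear V -> F^o} := HB.pack f L.
by exists (linfun fl) => v; rewrite lfunE.
Qed.

Lemma eigen_weight w :
  V' w -> (forall H : htilde n h0, eigen (act (htilde_elt H)) w) ->
  exists Lam, @weight_vector F n g h0 tA V' act Lam w.
Proof.
move=> hw ew; have [->|w0] := eqVneq w 0.
  exists 0; split; first exact: subspace0 Vprime_subspace.
  by move=> H; rewrite (lin0 (lin_actr _)) scaler0.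
have [k [i [j wkij]]] : exists k i j, w k i j != 0.
  apply: contrapT => nokij; case/eqP: w0.
  apply/fsfunP => k; apply/matrixP => i j.
  rewrite ff_zeroE mxE; apply/eqP; apply: contrapT => /negP wkij.
  by apply: nokij; exists k, i, j.
(* Reading the eigenvalue off one fixed non-zero entry of [w] makes it visibly linear in [H]. *)
pose f (H : htilde n h0) : F^o := act (htilde_elt H) w k i j / w k i j.
have lf : lin f.
  move=> c H H'; rewrite /f lin_htilde_elt lin_actl (lin_coef k) !mxE mulrDl.
  by rewrite -mulrA.
have [Lam LamE] := lin_hom lf.
exists Lam; split=> // H; have [c cw] := ew H.
by rewrite cw LamE /f cw ff_scaleE mxE mulfK.
Qed.

Lemma Vprime_weights : @direct_sum_of_weight_spaces F n g h0 tA V' act.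
Proof.
split=> [w hw|Lams w uL wL sumw].
  suff [b wb bP] :
      sum_of (fun v => exists Lam, @weight_vector F n g h0 tA V' act Lam v) w.
    by exists b.
  rewrite [w]finfam_sum; apply: sum_of_sum => k _.
  rewrite [w k]sum_pure single_sum; apply: sum_of_sum => i _.
  rewrite -[row i _]trmxK; move: (row i (w k))^T (hw k i) => v vk.
  (* After reduction to a pure tensor, its factor [v] in V_2 is split into joint eigenvectors for a
     basis of [h0], inside the same graded component. *)
  pose D (u : subvs_of h0) (v : 'cV[F]_Q) := op 0 (vsval u) *m v.
  have lD u : lin (D u) by move=> c x y; rewrite /D mulmxDr scalemxAr.
  have cD u u' v' : D u (D u' v') = D u' (D u v').
    have := twisted_op_bracket 0 0 (vsval u) (vsval u').
    rewrite h0_comm ?subvsP // (lin0 (lin_twisted_op _)) => /esym/eqP.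
    by rewrite subr_eq0 /D !mulmxA => /eqP->.
  have diag u v' :
      u \in (vbasis {:subvs_of h0} : seq _) -> sum_of (eigen (D u)) v'.
    by move=> _; apply: h0_diag; apply: subvsP.
  have [||b vE bE] := joint_eigen lD cD diag
    (U := fun v => v \in gr (Gclass m k)) _ _ vk.
  - by split=> [|c x y xk yk]; rewrite ?mem0v // memvD ?memvZ.
  - move=> u x xk; rewrite -[Gclass m k]add0r -(Gclass0 m).
    by apply: op_graded => //; apply: (subvP h0_gk); apply: subvsP.
  rewrite vE linear_sum mulmx_sumr single_sum.
  apply: sum_of_sum => y /bE[yk ey].
  apply: sum_of1; apply: eigen_weight.
    by apply/Vprime_single/homogeneous_pure.
  (* The elements of [h0] having [y] as eigenvector form a subspace, so a basis suffices. *)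
  have ey' u : eigen (D u) y.
    have sE : subspace (fun u => eigen (D u) y).
      split.
        exists 0; rewrite /D linear0 (lin0 (lin_twisted_op _)).
        by rewrite mul0mx scale0r.
      move=> c u1 u2 [c1 e1] [c2 e2]; exists (c * c1 + c2).
      by rewrite /D linearP /= lin_twisted_op mulmxDl -scalemxAl [X in _ *: X]e1
        [X in _ + X]e2 scalerA scalerDl.
    rewrite (coord_vbasis (memvf u)); apply: (subspace_sum sE) => j _.
    apply: (subspaceZ sE); apply: ey; apply: mem_nth; rewrite size_tuple //.
  move=> H; have [c cy] := ey' H.1.1; exists (c + dot H.2 (intv F k + beta)).
  rewrite act_htilde_single -singleZ -mulmxA -trmx_mul [X in X^T]cy scalerDl.
  by rewrite linearZ /= -scalemxAr.
move=> Lam LamL.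
refine (@eigen_separation F tA (htilde n h0) _ (fun H => act (htilde_elt H))
  (fun (Lam : 'Hom(htilde n h0, F^o)) H => Lam H) (fun v => v = 0) Lams w
  _ (subspace_zero _) _ uL _ _ sumw Lam LamL).
- by move=> H; apply: lin_actr.
- by move=> H v ->; rewrite (lin0 (lin_actr _)).
- by move=> Lam' H /wL[_ ->].
- move=> L1 L2 _ _ neqL; apply: contrapT => same; case/eqP: neqL.
  apply/lfunP => H.
  by apply/eqP; apply: contrapT => /negP neqH; apply: same; exists H.
Qed.

(** For [alpha u] non-zero, [op 0 u] and [op k x] satisfy the hypothesis of [commutator_nilpotent],
    and powers of the action on a [single] are governed by powers of [op k x]. *)
Lemma Vprime_integrable : @integrable F n g br sigma xi h0 tA V' act.
Proof.
split; first exact: Vprime_weights.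
move=> k alpha x alpha0 [xk ux] w _.
have [u alphau] : exists u, alpha u != 0.
  apply: contrapT => nou; case/eqP: alpha0; apply/lfunP => u; rewrite lfunE.
  by apply/eqP; apply: contrapT => /negP au; apply: nou; exists u.
have charF (d : nat) : (0 < d)%N -> d%:R != 0 :> F.
  by rewrite lt0n Num.Theory.pnatr_eq0.
have comm := twisted_op_bracket 0 k (vsval u) x.
rewrite add0r ux (linZ _ _ (lin_twisted_op _)) in comm.
have [d nil] := commutator_nilpotent charF alphau (esym comm).
exists d; rewrite [w]finfam_sum.
have lact e : lin (iter e (act (elt_loop k x))).
  elim: e => [//|e IHe]; exact: (lin_comp (lin_actr (elt_loop k x)) IHe).
rewrite (lin_sum _ _ _ (lact d)) [LHS]big1 // => j _.
suff -> e M : iter e (act (elt_loop k x)) (single j M) =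
    single (j + k *+ e) (M *m (iter e (mulmx (op k x)) 1%:M)^T).
  by rewrite nil trmx0 mulmx0 single0.
elim: e M => [|e IHe] M; first by rewrite addr0 trmx1 mulmx1.
by rewrite iterS IHe act_loop_single /= trmx_mul mulmxA mulrSr addrA.
Qed.

Lemma weight_support Lam w k i : @weight_vector F n g h0 tA V' act Lam w ->
  w k != 0 -> (k 0 i)%:~R + beta 0 i = Lam (0, 0, delta_mx 0 i).
Proof.
move=> [_ /(_ (0, 0, delta_mx 0 i))/fsfunP/(_ k)].
rewrite act_htilde_coef ff_scaleE [X in op 0 X](_ : _ = 0); last exact: linear0.
rewrite (lin0 (lin_twisted_op _)) trmx0 mulmx0 add0r.
move=> /eqP + wk; rewrite -subr_eq0 -scalerBl scaler_eq0 (negPf wk) orbF.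
rewrite subr_eq0 => /eqP<-; rewrite /dot (bigD1 i) //= mxE !eqxx mul1r.
rewrite big1 ?addr0 ?mxE // => i' ni.
by rewrite mxE (negPf ni) mul0r.
Qed.

(** The weights of the [d_i] determine the exponent, so all vectors of weight [Lam] live over one
    [k0], where the coefficients are matrices. *)
Lemma Vprime_finite_weights : @finite_dim_weight_spaces F n g h0 tA V' act.
Proof.
move=> Lam.
have [[w0 [k0 [hw0 w0k0]]]|no] :=
  pselect (exists w k, @weight_vector F n g h0 tA V' act Lam w /\ w k != 0);
  last first.
  exists [::] => w hw; exists (fun=> 0); rewrite big_ord0; apply/fsfunP => k.
  rewrite ff_zeroE; apply/eqP; apply: contrapT => /negP wk; apply: no.
  by exists w, k.
pose X : seq 'M[F]_(p, Q) := vbasis fullv.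
exists (map (single k0) X) => w hw.
have -> : w = single k0 (w k0).
  apply/fsfunP => k; rewrite singleE; case: eqP => [->//|/eqP kk0].
  apply/eqP; apply: contraNT kk0 => wk; apply/eqP/rowP => i.
  apply: (@intr_inj F); apply: (addIr (beta 0 i)).
  by rewrite (weight_support i hw wk) (weight_support i hw0 w0k0).
move: (w k0) => M.
have MX : M \in <<X>>%VS by rewrite (span_basis (vbasisP _)) memvf.
(* Indexing by plain numbers lets [size_map] change the range of the sum; the default 0 is never
   reached. *)
pose c j := if insub j is Some i then coord (in_tuple X) i M else 0.
exists (fun i => c i); rewrite size_map.
rewrite {1}(@coord_span _ _ _ (in_tuple X) _ MX) single_sum.
apply: eq_bigr => i _; rewrite (nth_map 0) ?ltn_ord // singleZ.
by rewrite /c valK.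
Qed.

End Weights.
End Graded.
End TensorAction.

(* If g acted by 0, then all lams i would vanish; but the orbit contains lam. *)
Lemma twisted_rep_neq0 (F : fieldType) (g : vectType F) (br : g -> g -> g)
    (n : nat) (m : 'I_n -> nat) (sigma : 'I_n -> 'End(g)) (xi : 'I_n -> F)
    (h : {vspace g}) (pos : dual F h -> Prop) (lam : dual F h)
    (l : nat) (lams : 'I_l -> dual F h)
    (q : 'I_l -> nat) (rho : forall i, g -> 'M[F]_(q i)) (k N : nat)
    (s : 'I_N -> 'I_l) (a : 'I_N -> 'rV[F]_n) :
  multiloop_data br m sigma xi -> lam != 0 ->
  (forall mu,
     (exists i, mu = lams i) <-> twist_orbit br m sigma xi pos lam mu) ->
  (forall i, hw_irrep br pos (lams i) (rho i)) ->
  (0 < k)%N -> (0 < \sum_(nu < N) q (s nu))%N ->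
  rep_iso (twisted_rep m sigma xi rho s a) (multiple_sum rho k) ->
  exists x, twisted_rep m sigma xi rho s a x != 0.
Proof.
move=> hsigma lam0 horbit hrho k0 Q0 [P [P' [PP' _ iso]]].
apply: contrapT => norep.
have rep0 x : twisted_rep m sigma xi rho s a x = 0.
  by apply/eqP; apply: contrapT => /negP rx; apply: norep; exists x.
have rho0 i x : rho i x = 0.
  have sum0 : multiple_sum rho k x = 0.
    by rewrite -[LHS]mulmx1 -PP' mulmxA -iso rep0 mulmx0 mul0mx.
  (* Each [rho i] occurs as a diagonal block because the multiplicity [k] is positive. *)
  have <- : submxblock (submxblock (multiple_sum rho k x) i i)
      (Ordinal k0) (Ordinal k0) = rho i x by rewrite !submxblock_diag.
  by apply/matrixP => i1 i2; rewrite sum0 !mxE.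
have lams0 i : lams i = 0.
  have [_ _ [v [v0 hv _]]] := hrho i; apply/lfunP => u; rewrite lfunE.
  have /esym/eqP := hv u; rewrite rho0 mul0mx scaler_eq0 (negPf v0) orbF.
  by move/eqP.
have [nu _] : exists nu : 'I_N, True.
  apply: contrapT => nonu; move: Q0; rewrite big1 // => nu _.
  by case: nonu; exists nu.
(* Membership of any weight in the orbit supplies a realization of V(lam), which the trivial
   character leaves unchanged. *)
have [_ _ [q' [rho' [hlam _]]]] :=
  (horbit (lams (s nu))).1 (ex_intro _ _ erefl).
have [|i lamE] := (horbit lam).2; last by rewrite lamE lams0 eqxx in lam0.
exists (fun=> 1); first by split=> // *; rewrite mulr1.
exists q', rho'; split=> //.
pose chi (_ : quotG m) : F := 1.
have -> // : (fun x => rho' (twist_aut sigma xi chi x)) = rho'.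
by apply/funext => x; rewrite (twist_aut1 hsigma).
Qed.

Theorem proposition6p1 (R : realType)
    (g : vectType R[i]) (br : g -> g -> g) (hbr : lie_bracket br)
    (hsimple : simple_lie br fullv)
    (h : {vspace g}) (hh : cartan br fullv h)
    (frm : g -> g -> R[i]) (hfrm : nice_form br frm)
    (n : nat) (m : 'I_n -> nat) (sigma : 'I_n -> 'End(g)) (xi : 'I_n -> R[i])
    (hsigma : multiloop_data br m sigma xi)
    (h0 : {vspace g}) (hLT : lie_torus br m sigma xi h h0)
    (Pi : seq (dual R[i] h)) (hPi : root_base br fullv Pi)
    (c1 c2 : R[i])
    (psi : dual R[i] (sl_cartan R[i] n)) (hpsi : sl_dominant_integral psi)
    (c : R[i]) (beta : 'rV[R[i]]_n)
    (lam : dual R[i] h)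
    (hlam : dominant_integral br fullv (positive_root br fullv Pi) lam)
    (hlam0 : lam != 0)
    (l : nat) (lams : 'I_l -> dual R[i] h) (hlams : injective lams)
    (horbit : forall mu, (exists i, mu = lams i) <->
       twist_orbit br m sigma xi (positive_root br fullv Pi) lam mu)
    (q : 'I_l -> nat) (rho : forall i, g -> 'M[R[i]]_(q i))
    (hrho : forall i,
       hw_irrep br (positive_root br fullv Pi) (lams i) (rho i))
    (k : nat) (hk : graded_schur_index m sigma xi rho k)
    (N : nat) (hN : N = (k * l)%N)
    (p : nat) (eta : 'M[R[i]]_n -> 'M[R[i]]_p) (heta : gl_irrep c psi eta)
    (s : 'I_N -> 'I_l) (a : 'I_N -> 'rV[R[i]]_n)
    (ha : forall nu, torsion_point m (a nu))
    (hiso : rep_iso (twisted_rep m sigma xi rho s a) (multiple_sum rho k))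
    (gr : quotG m -> {vspace 'cV[R[i]]_(\sum_(nu < N) q (s nu))})
    (hgr : graded_irreducible sigma xi (twisted_rep m sigma xi rho s a) gr) :
  let T := twisted_toroidal m sigma xi in
  let act := tensor_act eta beta rho s a in
  let V' := Vprime (p := p) gr in
  [/\ lie_module T (toroidal_bracket br frm c1 c2) V' act /\ level_zero V' act,
      irreducible_module T V' act,
      integrable br sigma xi h0 V' act,
      finite_dim_weight_spaces h0 V' act
    & nontrivial_loop_action sigma xi V' act].
Proof.
move=> T act V'.
have hrep i : lie_rep br (rho i) by have [] := hrho i.
have [eta_rep eta_irr _ _] := heta.
have [[k0 _] _] := hk; have [_ Q0 _] := hgr.
have rep_neq0 := twisted_rep_neq0 hsigma hlam0 horbit hrho k0 Q0 hiso.
have [_ [[h0_gk h0_comm _ _] h0h] _ _] := hLT.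
have h0_diag u : u \in h0 ->
    forall v : 'cV_(\sum_(nu < N) q (s nu)),
    sum_of (eigen (mulmx (twisted_op rho s a 0 u))) v.
  (* In degree 0 the twisting scalars are 1, so the blocks are the [rho (s nu) u], diagonalizable
     since [h0] lies in [h]. *)
  move=> u0; apply: (@sum_of_eigen_mxdiag _ N (fun nu => q (s nu))
    (fun nu => mpow (a nu) 0 *: rho (s nu) u)) => nu v; rewrite mpow0 scale1r.
  have [hr irr hw] := hrho (s nu).
  exact: (sum_of_eigen_cartan hh hr irr hw (subvP h0h u u0)).
split.
- split; first exact: (Vprime_module frm hbr hsigma beta eta_rep hrep ha hgr).
  by move=> i w _; apply: tensor_act_K.
- exact: (Vprime_irreducible hsigma beta eta_rep hrep ha hgr eta_irr rep_neq0).
- exact: (Vprime_integrable hsigma beta eta_rep hrep ha hgr h0_comm h0_gk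
  h0_diag).
- exact: (Vprime_finite_weights beta eta_rep hrep).
- exact: (Vprime_nontrivial hsigma beta eta_rep hrep ha hgr eta_irr rep_neq0).
Qed.
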